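(* Let $v=e^{i\theta}=(\cos\theta,\sin\theta)$ be a unit vector in $\mathbb{R}^2$. Then the $2$-form $w^v=d\Theta+\tau^v$ on $\mathcal{M}$ is a symplectic form, and the Hamiltonian system of the functional $H$ with respect to $w^v$ is the Ward equation $$-(q_tq^{-1})_t+(q_xq^{-1})_x+(q_yq^{-1})_y+[\,q_tq^{-1},\ \cos\theta\, q_xq^{-1}+\sin\theta\, q_yq^{-1}\,]=0$$ for $q$ (with $p=q^{-1}q_t$).
   Context: $\mathcal{M}$ is the cotangent bundle of the space of rapidly decaying smooth maps $q:\mathbb{R}^2\to U(n)$ (rapidly approaching the identity at infinity). Using left translation and the bilinear form $\langle A,B\rangle=\int_{\mathbb{R}^2}\mathrm{tr}(AB)\,dx\,dy$ to identify tangent and cotangent spaces, points of $\mathcal{M}$ are pairs $(p,q)$ with $p:\mathbb{R}^2\to u(n)$ rapidly decaying, and tangent vectors at $(p,q)$ are written $(\delta p,q^{-1}\delta q)$, a pair of rapidly decaying $u(n)$-valued maps. The canonical $1$-form is $\Theta_{(p,q)}(\delta p,q^{-1}\delta q)=\langle p,q^{-1}\delta q\rangle$, so that $$d\Theta_{(p,q)}((\delta_1p,q^{-1}\delta_1q),(\delta_2p,q^{-1}\delta_2q))=\langle\delta_1p,q^{-1}\delta_2q\rangle-\langle\delta_2p,q^{-1}\delta_1q\rangle-\langle p,[q^{-1}\delta_1q,q^{-1}\delta_2q]\rangle .$$ For $v=e^{i\theta}$ put $q_v=dq(v)=q_x\cos\theta+q_y\sin\theta$ and $$\tau^v_{(p,q)}((\delta_1p,q^{-1}\delta_1q),(\delta_2p,q^{-1}\delta_2q))=\langle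 q^{-1}q_v,[q^{-1}\delta_1q,q^{-1}\delta_2q]\rangle .$$ The Hamiltonian functional is $H(p,q)=\frac12\iint_{\mathbb{R}^2}\|p\|^2+\|q^{-1}dq\|^2\,dx\,dy$, where the squared norms are those of the form $\mathrm{tr}(AB)$, i.e. $\|p\|^2=\mathrm{tr}(p^2)$ and $\|q^{-1}dq\|^2=\mathrm{tr}((q^{-1}q_x)^2)+\mathrm{tr}((q^{-1}q_y)^2)$. The Hamiltonian vector field $X_H$ is defined by $dH(\cdot)=w^v(\cdot,X_H)$, and the Hamiltonian system is $(p_t,q^{-1}q_t)=X_H(p,q)$. A symplectic form means a closed, (weakly) nondegenerate $2$-form. *)

(* Defs.v *)
From HB Require Import structures.
From mathcomp Require Import all_boot all_order all_algebra.
From mathcomp Require Import all_classical all_reals all_analysis.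
From mathcomp Require Import complex.

Set Implicit Arguments.
Unset Strict Implicit.
Unset Printing Implicit Defensive.

Import Order.TTheory GRing.Theory Num.Theory.
Import numFieldNormedType.Exports.

Local Open Scope classical_set_scope.
Local Open Scope sesquilinear_scope.
Local Open Scope complex_scope.
Local Open Scope ring_scope.

Section Defs.
Variables (R : realType) (n : nat).

Notation plane := (R * R)%type.
Notation spacetime := (R * (R * R))%type.
Notation mat := 'M[R[i]]_n.

Definition commx (A B : mat) : mat := A *m B - B *m A.

Definition skewhermmx (A : mat) : Prop := A ^t* = - A.

(* R[i] is not a normed R-module in the library, so the directional derivative
   of a complex matrix-valued function is taken on the real and imaginary parts
   of its entries. *)
Definition dmx (V : normedModType R) (v : V) (F : V -> mat) : V -> mat :=
  fun z => \matrix_(i, j)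
    ('D_v (fun w => complex.Re (F w i j)) z +i*
     'D_v (fun w => complex.Im (F w i j)) z)%C.

Definition iter_dmx (V : normedModType R) (vs : seq V) (F : V -> mat) :=
  foldr (@dmx V) F vs.

(* C^oo on the open set A: every iterated directional derivative is Frechet
   differentiable at every point of A. *)
Definition smooth_on (V : normedModType R) (A : set V) (F : V -> mat) : Prop :=
  forall (vs : seq V) (i j : 'I_n) (z : V), A z ->
    differentiable (fun w => complex.Re (iter_dmx vs F w i j)) z /\
    differentiable (fun w => complex.Im (iter_dmx vs F w i j)) z.

Definition rapidly_decaying (F : plane -> mat) : Prop :=
  smooth_on setT F /\
  forall (vs : seq plane) (k : nat), exists B : R, forall z i j,
    (1 + `|z|) ^+ k * Normc.normc (iter_dmx vs F z i j) <= B.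

Definition joint (F : R -> plane -> mat) : spacetime -> mat :=
  fun w => F w.1 w.2.

(* Smooth curves, parametrized by the open interval I, in the Frechet space of
   rapidly decaying functions: jointly smooth functions whose derivatives of
   all orders, including those in the parameter, decay rapidly, uniformly for
   the parameter in compact subintervals of I. *)
Definition rapidly_decaying_curve (I : set R) (F : R -> plane -> mat) : Prop :=
  smooth_on [set w : spacetime | I w.1] (joint F) /\
  forall a b : R, [set` `[a, b]] `<=` I ->
  forall (vs : seq spacetime) (k : nat), exists B : R,
    forall t, t \in `[a, b] -> forall z i j,
    (1 + `|z|) ^+ k * Normc.normc (iter_dmx vs (joint F) (t, z) i j) <= B.

Definition dir_x : plane := (1, 0).
Definition dir_y : plane := (0, 1).
Definition st_t : spacetime := (1, (0, 0)).
Definition st_x : spacetime := (0, (1, 0)).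
Definition st_y : spacetime := (0, (0, 1)).

Definition algebra_map (xi : plane -> mat) : Prop :=
  rapidly_decaying xi /\ forall z, skewhermmx (xi z).

Definition group_map (q : plane -> mat) : Prop :=
  rapidly_decaying (fun z => q z - 1%:M) /\ forall z, q z \is unitarymx.

Definition algebra_curve (I : set R) (xi : R -> plane -> mat) : Prop :=
  rapidly_decaying_curve I xi /\ forall t, I t -> forall z, skewhermmx (xi t z).

Definition group_curve (I : set R) (q : R -> plane -> mat) : Prop :=
  rapidly_decaying_curve I (fun t z => q t z - 1%:M) /\
  forall t, I t -> forall z, q t z \is unitarymx.

(* The carrier both of points (p, q) and of tangent vectors
   (delta p, q^-1 delta q); [phase] and [tangent] single them out. The tangent
   space is the same at all points. *)
Definition fields : Type := ((plane -> mat) * (plane -> mat))%type.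

Definition phase (m : fields) : Prop := algebra_map m.1 /\ group_map m.2.

Definition tangent (X : fields) : Prop := algebra_map X.1 /\ algebra_map X.2.

Definition phase_curve (I : set R) (c : R -> fields) : Prop :=
  algebra_curve I (fun t => (c t).1) /\ group_curve I (fun t => (c t).2).

Definition tangent_curve (I : set R) (X : R -> fields) : Prop :=
  algebra_curve I (fun t => (X t).1) /\ algebra_curve I (fun t => (X t).2).

Definition logder_t (q : R -> plane -> mat) (t : R) : plane -> mat :=
  fun z => invmx (q t z) *m dmx st_t (joint q) (t, z).

Definition velocity (c : R -> fields) (t : R) : fields :=
  (fun z => dmx st_t (joint (fun s => (c s).1)) (t, z),
   logder_t (fun s => (c s).2) t).

(* A tangent vector X is also the left-invariant vector field with constant
   value X in the trivialization; [bracket] is the Lie bracket of two such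
   vector fields. *)
Definition bracket (X Y : fields) : fields :=
  (fun=> 0, fun z => commx (X.2 z) (Y.2 z)).

Definition curve_at (m X : fields) (I : set R) (c : R -> fields) : Prop :=
  [/\ open I, is_interval I, I 0, phase_curve I c & c 0 = m /\ velocity c 0 = X].

(* The first conjunct keeps the second from holding vacuously, and makes l
   unique. *)
Definition is_dirderiv (f : fields -> R) (m X : fields) (l : R) : Prop :=
  (exists I c, curve_at m X I c) /\
  forall I c, curve_at m X I c -> is_derive (0 : R) (1 : R) (f \o c) l.

Definition dirderiv (f : fields -> R) (m X : fields) : R :=
  xget 0 [set l | is_dirderiv f m X l].

Definition one_form := fields -> fields -> R.
Definition two_form := fields -> fields -> fields -> R.

(* The invariant formulas for the exterior derivative. As d alpha and d omega
   are tensorial, their values on tangent vectors are computed by extending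
   these to left-invariant vector fields. *)
Definition ext_deriv1 (alpha : one_form) : two_form := fun m X Y =>
  dirderiv (alpha^~ Y) m X - dirderiv (alpha^~ X) m Y - alpha m (bracket X Y).

Definition ext_deriv2 (omega : two_form) (m X Y Z : fields) : R :=
  dirderiv (fun m' => omega m' Y Z) m X
  - dirderiv (fun m' => omega m' X Z) m Y
  + dirderiv (fun m' => omega m' X Y) m Z
  - omega m (bracket X Y) Z
  + omega m (bracket X Z) Y
  - omega m (bracket Y Z) X.

(* Smoothness of omega is smoothness along smooth curves, which on Frechet
   manifolds is equivalent to the usual notion. *)
Definition is_two_form (omega : two_form) : Prop :=
  [/\ forall m, phase m -> forall (a : R) X Y Z,
        tangent X -> tangent Y -> tangent Z ->
        omega m (a%:C *: X + Y) Z = a * omega m X Z + omega m Y Z,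
      forall m, phase m -> forall X Y, tangent X -> tangent Y ->
        omega m X Y = - omega m Y X
    & forall (I : set R) c X Y, open I -> is_interval I ->
        phase_curve I c -> tangent_curve I X -> tangent_curve I Y ->
        forall (k : nat) t, I t ->
        derivable (derive1n k (fun s => omega (c s) (X s) (Y s))) t 1].

Definition closed_form (omega : two_form) : Prop :=
  forall m X Y Z, phase m -> tangent X -> tangent Y -> tangent Z ->
    (exists l, is_dirderiv (fun m' => omega m' Y Z) m X l) /\
    ext_deriv2 omega m X Y Z = 0.

Definition weakly_nondegenerate (omega : two_form) : Prop :=
  forall m X, phase m -> tangent X ->
    (forall Y, tangent Y -> omega m X Y = 0) -> X = 0.

Definition symplectic_form (omega : two_form) : Prop :=
  [/\ is_two_form omega, closed_form omega & weakly_nondegenerate omega].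

Definition smooth_vector_field (X : fields -> fields) : Prop :=
  (forall m, phase m -> tangent (X m)) /\
  forall (I : set R) c, open I -> is_interval I ->
    phase_curve I c -> tangent_curve I (X \o c).

Definition hamiltonian_vector_field (omega : two_form) (H : fields -> R)
    (X : fields -> fields) : Prop :=
  smooth_vector_field X /\
  forall m Y, phase m -> tangent Y -> is_dirderiv H m Y (omega m Y (X m)).

Definition integral_curve (I : set R) (X : fields -> fields) (c : R -> fields) :
    Prop :=
  phase_curve I c /\ forall t, I t -> velocity c t = X (c t).

(* tr (A B) is real for A and B in u(n). *)
Definition retr (A : mat) : R := complex.Re (\tr A).

Definition integral_plane (f : plane -> R) : R :=
  \int[(@lebesgue_measure R \x @lebesgue_measure R)%E]_z f z.

Definition pairing (A B : plane -> mat) : R :=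
  integral_plane (fun z => retr (A z *m B z)).

Definition Theta : one_form := fun m X => pairing m.1 X.2.

Definition logder (v : plane) (q : plane -> mat) : plane -> mat :=
  fun z => invmx (q z) *m dmx v q z.

Definition tau (theta : R) : two_form := fun m X Y =>
  pairing (fun z => invmx (m.2 z) *m
                    ((cos theta)%:C *: dmx dir_x m.2 z +
                     (sin theta)%:C *: dmx dir_y m.2 z))
          (fun z => commx (X.2 z) (Y.2 z)).

Definition ward_form (theta : R) : two_form := fun m X Y =>
  ext_deriv1 Theta m X Y + tau theta m X Y.

(* The squared norms are those of tr (A B), hence nonpositive on u(n). *)
Definition hamiltonian (m : fields) : R :=
  2^-1 * integral_plane (fun z =>
    retr (m.1 z *m m.1 z)
    + (retr (logder dir_x m.2 z *m logder dir_x m.2 z)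
       + retr (logder dir_y m.2 z *m logder dir_y m.2 z))).

Definition rlogder (v : spacetime) (q : R -> plane -> mat) : spacetime -> mat :=
  fun w => dmx v (joint q) w *m invmx (joint q w).

Definition ward_equation (theta : R) (I : set R) (q : R -> plane -> mat) : Prop :=
  forall t, I t -> forall z,
    - dmx st_t (rlogder st_t q) (t, z)
    + dmx st_x (rlogder st_x q) (t, z)
    + dmx st_y (rlogder st_y q) (t, z)
    + commx (rlogder st_t q (t, z))
            ((cos theta)%:C *: rlogder st_x q (t, z)
             + (sin theta)%:C *: rlogder st_y q (t, z)) = 0.

End Defs.

(* Main.v *)
Require Import Defs.
From mathcomp Require Import all_boot all_order all_algebra.
From mathcomp Require Import all_classical all_reals all_analysis.
From mathcomp Require Import complex measurable_realfun.
From mathcomp Require Import ring lra.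

Set Implicit Arguments.
Unset Strict Implicit.
Unset Printing Implicit Defensive.

Import Order.TTheory GRing.Theory Num.Theory.
Import numFieldNormedType.Exports.

Local Open Scope classical_set_scope.
Local Open Scope sesquilinear_scope.
Local Open Scope complex_scope.
Local Open Scope ring_scope.

(** Write u = q^-1 q_v and L_a = q^-1 d_a q for a direction a of space-time.
    Computing d Theta turns the 2-form into
      w(X, Y) = int tr (X1 Y2 - Y1 X2 + (u - p) [X2, Y2])       (ward_formE).

    It is nondegenerate because - tr (A A) is a positive definite form on u(n):
    pairing X with (X2, 0) gives X2 = 0, and then pairing it with (0, X1) gives
    X1 = 0. It is closed because q^-1 dq is flat, d_a L_b - d_b L_a = [L_b, L_a]
    (potential_flat), so that u varies by d_v X2 + [u, X2] along a curve with
    velocity X (curve_at_dvpotential). In the invariant formula for dw the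
    Jacobi identity and the cyclicity of the trace then cancel everything but
    d_v tr (X2 [Y2, Z2]) (trace_closed), the derivative of a rapidly decaying
    function, whose integral vanishes (trint_vdmx).

    By flatness again, and after integrating by parts,
      dH (Y) = int tr (p Y1 - (d_x L_x + d_y L_y) Y2),
    which is w(Y, X_H) for X_H = (d_x L_x + d_y L_y + [p, u], p)
    (is_dirderiv_hamiltonian); nondegeneracy makes X_H unique. Its integral
    curves satisfy p = L_t and d_t L_t = d_x L_x + d_y L_y + [L_t, u]. The
    right logarithmic derivatives of the Ward equation are the conjugates
    q L_a q^-1, and d_a (q L_a q^-1) = q (d_a L_a) q^-1 since [L_a, L_a] = 0, so
    the Ward equation is the conjugate by q of this evolution equation
    (ward_expression).

    The analysis needed is this. Points and tangent vectors are treated as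
    constant curves, so that one calculus, for functions on space-time, serves
    everywhere. Such a function is rapidly decaying if all its derivatives are,
    locally uniformly in time; this class is stable under derivatives and under
    products with functions whose derivatives are all bounded, and the integral
    of the trace of a member may be differentiated in time under the integral
    sign (is_derive_trint). Mixed derivatives commute by Schwarz's theorem
    (derive_comm). Directional derivatives on the phase space are only
    meaningful if each tangent vector (xi, eta) is the velocity of some curve:
    (p + t xi, q c(t)) is one, where c(t) is the Cayley transform
    (1 + t eta / 2) (1 - t eta / 2)^-1, unitary and bounded with all its
    derivatives (curve_at_exists). *)

(** * Symmetry of second directional derivatives *)

Section Schwarz.
Variables (R : realType) (V : normedModType R).

(** Directional derivatives are ordinary derivatives along a line, to which
    one-variable theorems apply. *)
Lemma is_derive_line (f : V -> R) (a u : V) (s : R) :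
  derivable f (s *: u + a) u ->
  is_derive s 1 (fun x : R => f (x *: u + a)) ('D_u f (s *: u + a)).
Proof.
have E : (fun h : R => h^-1 *: (((fun x : R => f (x *: u + a)) \o shift s) (h *: 1)
            - (fun x : R => f (x *: u + a)) s)) =
        (fun h : R => h^-1 *: ((f \o shift (s *: u + a)) (h *: u) - f (s *: u + a))).
  by apply/funext => h /=; rewrite [h *: 1]mulr1 scalerDl addrA.
by move=> df; split; rewrite /derivable /derive E.
Qed.

(** By the mean value theorem along u, the second difference is h times an
    increment of 'D_u f in the direction v, and the differential of 'D_u f at
    z controls that increment up to o(h). *)
Lemma second_difference (f : V -> R) (u v z : V) :
  (\forall w \near z, differentiable f w) ->
  differentiable ('D_u f) z ->
  forall e : R, 0 < e -> \forall h \near (0:R)^'+,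
   `|f (h *: u + h *: v + z) - f (h *: u + z) - f (h *: v + z) + f z
     - h ^+ 2 * 'D_v ('D_u f) z| <= e * h ^+ 2.
Proof.
move=> nf dg e e0.
set g := 'D_u f.
pose M := `|u| + `|v| + 1.
have M0 : 0 < M by rewrite /M; have := normr_ge0 u; have := normr_ge0 v; lra.
(* Half of e is spent on each of the two values of 'D_u f in the increment below. *)
pose e' := e / (2 * M).
have e'0 : 0 < e' by rewrite /e' divr_gt0 // mulr_gt0.
have est : \forall k \near (0:V), `|g (k + z) - g z - 'd g z k| <= e' * `|k|.
  have /diff_locallyP [_ E] := dg.
  have /eqaddoP/(_ e' e'0) := E.
  apply: filterS => k /=.
  by rewrite !fctE /= opprD addrA.
have {}nf : \forall k \near (0:V), differentiable f (k + z).
  by move: nf; rewrite (near_shift 0) /=; apply: filterS => k; rewrite /= subr0.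
have [d d0 H] : exists2 d : R, 0 < d & forall k : V, `|k| < d ->
    `|g (k + z) - g z - 'd g z k| <= e' * `|k| /\ differentiable f (k + z).
  have [d /= d0 H] := nbhs_norm0P.1 (filterI est nf).
  by exists d => // k kd; apply: H.
near=> h.
have h0 : 0 < h by near: h; exact: nbhs_right_gt.
have hd : h * M < d.
  by rewrite -ltr_pdivlMr //; near: h; apply: nbhs_right_lt; rewrite divr_gt0.
have small s : 0 <= s <= h -> `|s *: u + h *: v| <= h * (`|u| + `|v|) /\
    `|s *: u| <= h * (`|u| + `|v|).
  move=> /andP[s0 sh].
  have A1 : `|s *: u| <= h * `|u| by rewrite normrZ ger0_norm // ler_wpM2r.
  have A2 : `|h *: v| = h * `|v| by rewrite normrZ gtr0_norm.
  have := ler_normD (s *: u) (h *: v).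
  have : 0 <= h * `|v| by rewrite mulr_ge0 // ltW.
  rewrite mulrDr; split; lra.
have hM : h * (`|u| + `|v|) < d by rewrite (lt_trans _ hd) // ltr_pM2l // /M; lra.
pose phi := fun s : R => f (s *: u + (h *: v + z)) - f (s *: u + z).
pose dphi := fun s : R => g (s *: u + (h *: v + z)) - g (s *: u + z).
have dphiP s : 0 <= s <= h -> is_derive s 1 phi (dphi s).
  move=> /small [S1 S2]; apply: is_deriveB; apply: is_derive_line.
    apply: diff_derivable; rewrite addrA; apply: (H _ _).2.
    exact: le_lt_trans hM.
  by apply: diff_derivable; apply: (H _ _).2; exact: le_lt_trans hM.
have [||s] := @MVT R phi dphi 0 h h0.
- by move=> s; rewrite in_itv /= => /andP[s0 sh]; apply: dphiP; rewrite !ltW.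
- apply: derivable_within_continuous => s; rewrite in_itv /= => /dphiP [] //.
rewrite in_itv /= => /andP[/ltW s0 /ltW sh] E.
have [S1 S2] := small s (introT andP (conj s0 sh)).
have [B1 _] := H _ (le_lt_trans S1 hM).
have [B2 _] := H _ (le_lt_trans S2 hM).
have -> : f (h *: u + h *: v + z) - f (h *: u + z) - f (h *: v + z) + f z
   = phi h - phi 0.
  by rewrite /phi scale0r !add0r !addrA; ring.
rewrite E subr0 deriveE // {E}.
have -> : dphi s * h - h ^+ 2 * 'd g z v =
   h * ((g (s *: u + h *: v + z) - g z - 'd g z (s *: u + h *: v)) -
         (g (s *: u + z) - g z - 'd g z (s *: u))).
  have -> : dphi s = g (s *: u + h *: v + z) - g (s *: u + z) by rewrite /dphi -addrA.
  rewrite linearD !linearZ /=; rewrite /GRing.scale /=; ring.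
rewrite normrM gtr0_norm // (_ : e * h ^+ 2 = h * (e * h)); last by ring.
rewrite ler_wpM2l ?(ltW h0) //.
apply: le_trans (ler_normB _ _) _.
apply: le_trans (lerD B1 B2) _.
have : e' * `|s *: u + h *: v| <= e' * (h * M).
  rewrite ler_wpM2l ?(ltW e'0) //; apply: le_trans S1 _; rewrite ler_wpM2l ?(ltW h0) // /M; lra.
have : e' * `|s *: u| <= e' * (h * M).
  rewrite ler_wpM2l ?(ltW e'0) //; apply: le_trans S2 _; rewrite ler_wpM2l ?(ltW h0) // /M; lra.
have : e' * (h * M) = e * h / 2 by rewrite /e'; field; rewrite gt_eqF.
lra.
Unshelve. all: by end_near. Qed.

Lemma close_quotients (a b F F1 F2 F0 e c : R) :
  `|F - F1 - F2 + F0 - c * a| <= e / 2 * c ->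
  `|F - F2 - F1 + F0 - c * b| <= e / 2 * c -> `|(a - b) * c| <= e * c.
Proof.
rewrite mulrBl !ler_norml => /andP[A1 A2] /andP[B1 B2]; apply/andP; split; lra.
Qed.

(** Both mixed derivatives are the limit of the same second difference, which
    is symmetric in u and v. *)
Lemma derive_comm (f : V -> R) (u v z : V) :
  (\forall w \near z, differentiable f w) ->
  differentiable ('D_u f) z -> differentiable ('D_v f) z ->
  'D_v ('D_u f) z = 'D_u ('D_v f) z.
Proof.
move=> nf du dv; apply/eqP; rewrite -subr_eq0 -normr_le0; apply/ler_addgt0Pr => e e0.
rewrite add0r.
have e20 : 0 < e / 2 by rewrite divr_gt0.
have H1 := second_difference v nf du e20.
have H2 := second_difference u nf dv e20.
have [h [[K1 K2] /= h0]] := filter_ex (filterI (filterI H1 H2) (nbhs_right_gt 0)).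
have h2 : 0 < h ^+ 2 by rewrite exprn_gt0.
rewrite -(ler_pM2r h2).
rewrite -[X in _ * X](gtr0_norm h2) -normrM.
rewrite (addrC (h *: v)) in K2.
exact: (close_quotients K1 K2).
Qed.
End Schwarz.

(** * Directional derivatives of complex functions *)

Section ComplexCalculus.
Variables (R : realType) (V : normedModType R).
Local Notation C := (R[i]).
Local Notation conjC := Num.conj.
Implicit Types (f g : V -> C) (v z : V).

Definition cdiff f z :=
  differentiable (fun w => complex.Re (f w)) z /\
  differentiable (fun w => complex.Im (f w)) z.

Definition cder v f z : C :=
  ('D_v (fun w => complex.Re (f w)) z +i* 'D_v (fun w => complex.Im (f w)) z)%C.

Lemma ReD (x y : C) : complex.Re (x + y) = complex.Re x + complex.Re y.
Proof. by case: x y => [a b] [c d]. Qed.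
Lemma ImD (x y : C) : complex.Im (x + y) = complex.Im x + complex.Im y.
Proof. by case: x y => [a b] [c d]. Qed.
Lemma ReN (x : C) : complex.Re (- x) = - complex.Re x.
Proof. by case: x => [a b]. Qed.
Lemma ImN (x : C) : complex.Im (- x) = - complex.Im x.
Proof. by case: x => [a b]. Qed.
Lemma ReM (x y : C) : complex.Re (x * y) =
  complex.Re x * complex.Re y - complex.Im x * complex.Im y.
Proof. by case: x y => [a b] [c d]. Qed.
Lemma ImM (x y : C) : complex.Im (x * y) =
  complex.Re x * complex.Im y + complex.Im x * complex.Re y.
Proof. by case: x y => [a b] [c d]. Qed.
Lemma Re_conjC (x : C) : complex.Re (conjC x) = complex.Re x.
Proof. by case: x. Qed.
Lemma Im_conjC (x : C) : complex.Im (conjC x) = - complex.Im x.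
Proof. by case: x. Qed.

Lemma complex_eq (x y : C) : complex.Re x = complex.Re y ->
  complex.Im x = complex.Im y -> x = y.
Proof. by case: x y => [a b] [c d] /= -> ->. Qed.

Lemma cdiff_cst (a : C) z : cdiff (fun=> a) z.
Proof. by split; exact: differentiable_cst. Qed.

Lemma cder_cst v (a : C) z : cder v (fun=> a) z = 0.
Proof. by rewrite /cder !derive_cst. Qed.

Lemma cdiffD f g z : cdiff f z -> cdiff g z -> cdiff (fun w => f w + g w) z.
Proof.
move=> [f1 f2] [g1 g2]; split.
- by under eq_fun do rewrite ReD; exact: differentiableD.
- by under eq_fun do rewrite ImD; exact: differentiableD.
Qed.

Lemma cderD v f g z : cdiff f z -> cdiff g z ->
  cder v (fun w => f w + g w) z = cder v f z + cder v g z.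
Proof.
move=> [f1 f2] [g1 g2]; apply: complex_eq; rewrite ?ReD ?ImD /=.
- by under eq_fun do rewrite ReD; rewrite deriveD //; exact: diff_derivable.
- by under eq_fun do rewrite ImD; rewrite deriveD //; exact: diff_derivable.
Qed.

Lemma cdiffN f z : cdiff f z -> cdiff (fun w => - f w) z.
Proof.
move=> [f1 f2]; split.
- by under eq_fun do rewrite ReN; exact: differentiableN.
- by under eq_fun do rewrite ImN; exact: differentiableN.
Qed.

Lemma cderN v f z : cdiff f z -> cder v (fun w => - f w) z = - cder v f z.
Proof.
move=> [f1 f2]; apply: complex_eq; rewrite ?ReN ?ImN /=.
- by under eq_fun do rewrite ReN; rewrite deriveN //; exact: diff_derivable.
- by under eq_fun do rewrite ImN; rewrite deriveN //; exact: diff_derivable.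
Qed.

Lemma cdiffJ f z : cdiff f z -> cdiff (fun w => conjC (f w)) z.
Proof.
move=> [f1 f2]; split.
- by under eq_fun do rewrite Re_conjC.
- by under eq_fun do rewrite Im_conjC; exact: differentiableN.
Qed.

Lemma cderJ v f z : cdiff f z ->
  cder v (fun w => conjC (f w)) z = conjC (cder v f z).
Proof.
move=> [f1 f2]; apply: complex_eq; rewrite ?Re_conjC ?Im_conjC /=.
- by under eq_fun do rewrite Re_conjC.
- by under eq_fun do rewrite Im_conjC; rewrite deriveN //; exact: diff_derivable.
Qed.

Lemma cdiffM f g z : cdiff f z -> cdiff g z -> cdiff (fun w => f w * g w) z.
Proof.
move=> [f1 f2] [g1 g2]; split.
- under eq_fun do rewrite ReM.
  by apply: differentiableB; exact: differentiableM.
- under eq_fun do rewrite ImM.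
  by apply: differentiableD; exact: differentiableM.
Qed.

Lemma cderM v f g z : cdiff f z -> cdiff g z ->
  cder v (fun w => f w * g w) z = cder v f z * g z + f z * cder v g z.
Proof.
move=> [f1 f2] [g1 g2]; have F1 := @diff_derivable _ _ _ _ _ v f1; have F2 := @diff_derivable _ _ _ _ _ v f2.
have G1 := @diff_derivable _ _ _ _ _ v g1; have G2 := @diff_derivable _ _ _ _ _ v g2.
have R1 : (fun w => complex.Re (f w * g w)) =
  (fun w => complex.Re (f w)) * (fun w => complex.Re (g w)) -
  (fun w => complex.Im (f w)) * (fun w => complex.Im (g w)).
  by apply/funext => w; rewrite ReM.
have I1 : (fun w => complex.Im (f w * g w)) =
  (fun w => complex.Re (f w)) * (fun w => complex.Im (g w)) +
  (fun w => complex.Im (f w)) * (fun w => complex.Re (g w)).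
  by apply/funext => w; rewrite ImM.
have DR := derive_val (is_derive := is_deriveB (is_deriveM (derivableP F1) (derivableP G1))
   (is_deriveM (derivableP F2) (derivableP G2))).
have DI := derive_val (is_derive := is_deriveD (is_deriveM (derivableP F1) (derivableP G2))
   (is_deriveM (derivableP F2) (derivableP G1))).
rewrite /cder R1 I1 DR DI /GRing.scale /=.
apply: complex_eq; rewrite ?ReD ?ImD ?ReM ?ImM /=; clear; ring.
Qed.

Lemma cdiff_sum (I : Type) (r : seq I) (F : I -> V -> C) z :
  (forall i, cdiff (F i) z) -> cdiff (fun w => \sum_(i <- r) F i w) z.
Proof.
move=> dF; elim: r => [|i r IH].
  by under eq_fun do rewrite big_nil; exact: cdiff_cst.
by under eq_fun do rewrite big_cons; exact: cdiffD.
Qed.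

Lemma cder_sum v (I : Type) (r : seq I) (F : I -> V -> C) z :
  (forall i, cdiff (F i) z) ->
  cder v (fun w => \sum_(i <- r) F i w) z = \sum_(i <- r) cder v (F i) z.
Proof.
move=> dF; elim: r => [|i r IH].
  by under eq_fun do rewrite big_nil; rewrite big_nil cder_cst.
under eq_fun do rewrite big_cons; rewrite cderD ?IH ?big_cons //.
exact: cdiff_sum.
Qed.

Lemma cdiff_prod (I : Type) (r : seq I) (F : I -> V -> C) z :
  (forall i, cdiff (F i) z) -> cdiff (fun w => \prod_(i <- r) F i w) z.
Proof.
move=> dF; elim: r => [|i r IH].
  by under eq_fun do rewrite big_nil; exact: cdiff_cst.
by under eq_fun do rewrite big_cons; exact: cdiffM.
Qed.

(** The real and imaginary parts of 1 / f are quotients by |f|^2. *)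
Lemma cdiffV f z : f z != 0 -> cdiff f z -> cdiff (fun w => (f w)^-1) z.
Proof.
move=> fz [f1 f2].
pose N w := complex.Re (f w) * complex.Re (f w) + complex.Im (f w) * complex.Im (f w).
have Nz : N z != 0.
  rewrite /N -!expr2 paddr_eq0 ?sqr_ge0 // !sqrf_eq0.
  by move: fz; rewrite eq_complex.
have dN : differentiable N z by apply: differentiableD; exact: differentiableM.
have dV : differentiable (fun w => (N w)^-1) z by exact: differentiableV.
split.
- rewrite (_ : (fun w => _) = (fun w => complex.Re (f w) * (N w)^-1)).
    exact: differentiableM.
  by apply/funext => w; rewrite /N; case: (f w) => a b /=; rewrite !expr2.
- rewrite (_ : (fun w => _) = (fun w => - (complex.Im (f w) * (N w)^-1))).
    by apply: differentiableN; exact: differentiableM.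
  by apply/funext => w; rewrite /N; case: (f w) => a b /=; rewrite !expr2 // mulNr.
Qed.

Lemma cder_comm f u v z : (\forall w \near z, cdiff f w) ->
  cdiff (cder u f) z -> cdiff (cder v f) z ->
  cder v (cder u f) z = cder u (cder v f) z.
Proof.
move=> df [u1 u2] [v1 v2]; apply: complex_eq => /=; apply: derive_comm => //.
- by apply: filterS df => w [].
- by apply: filterS df => w [].
Qed.


(** Differentiability is defined through a chosen differential, so locality
    needs the uniqueness of the differential. *)
Lemma near_eq_differentiable (W : normedModType R) (f g : V -> W) z :
  (\near z, f z = g z) -> differentiable f z -> differentiable g z.
Proof.
move=> fg /diff_locallyP[dfc E].
have fgz := nbhs_singleton fg.
have E' : g \o shift z = cst (g z) + 'd f z +o_ 0 id.
  apply/eqaddoP => e e0; move/eqaddoP : E => /(_ e e0).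
  have : \forall k \near 0, f (k + z) = g (k + z).
    move: fg; rewrite (near_shift 0) /=.
    by apply: filterS => k; rewrite /= subr0.
  by apply: filterS2 => k; rewrite !fctE /= fgz => ->.
by apply/diff_locallyP; rewrite (diff_unique dfc E').
Qed.

Lemma near_eq_cdiff f g z : (\near z, f z = g z) -> cdiff f z -> cdiff g z.
Proof.
move=> fg [f1 f2]; split.
- by apply: near_eq_differentiable f1; apply: filterS fg => w ->.
- by apply: near_eq_differentiable f2; apply: filterS fg => w ->.
Qed.

Lemma near_eq_cder v f g z : (\near z, f z = g z) -> cder v f z = cder v g z.
Proof.
by move=> fg; congr (_ +i* _)%C; apply: near_eq_derive; apply: filterS fg => w ->.
Qed.
End ComplexCalculus.

(** * Directional derivatives of matrix functions *)

Section MatrixCalculus.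
Variables (R : realType) (n : nat) (V : normedModType R).
Local Notation mat := 'M[R[i]]_n.
Implicit Types (F G : V -> mat) (v z : V).

Definition mdiff F z := forall i j, cdiff (fun w => F w i j) z.

Lemma dmxE v F z i j : dmx v F z i j = cder v (fun w => F w i j) z.
Proof. by rewrite mxE. Qed.

Lemma near_eq_mdiff F G z : (\near z, F z = G z) -> mdiff F z -> mdiff G z.
Proof.
by move=> FG dF i j; apply: near_eq_cdiff (dF i j); apply: filterS FG => w ->.
Qed.

Lemma near_eq_dmx v F G z : (\near z, F z = G z) -> dmx v F z = dmx v G z.
Proof.
move=> FG; apply/matrixP => i j; rewrite !dmxE; apply: near_eq_cder.
by apply: filterS FG => w ->.
Qed.

Lemma mdiff_cst (A : mat) z : mdiff (fun=> A) z.
Proof. by move=> i j; exact: cdiff_cst. Qed.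

Lemma dmx_cst v (A : mat) z : dmx v (fun=> A) z = 0.
Proof. by apply/matrixP => i j; rewrite dmxE cder_cst mxE. Qed.

Lemma mdiffD F G z : mdiff F z -> mdiff G z -> mdiff (fun w => F w + G w) z.
Proof.
move=> dF dG i j; under eq_fun do rewrite mxE; exact: cdiffD.
Qed.

Lemma dmxD v F G z : mdiff F z -> mdiff G z ->
  dmx v (fun w => F w + G w) z = dmx v F z + dmx v G z.
Proof.
move=> dF dG; apply/matrixP => i j.
have E : (fun w => (F w + G w) i j) = (fun w => F w i j + G w i j).
  by apply/funext => w; rewrite mxE.
by rewrite [LHS]dmxE E cderD // [RHS]mxE !dmxE.
Qed.

Lemma mdiffN F z : mdiff F z -> mdiff (fun w => - F w) z.
Proof.
move=> dF i j; under eq_fun do rewrite mxE; exact: cdiffN.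
Qed.

Lemma dmxN v F z : mdiff F z -> dmx v (fun w => - F w) z = - dmx v F z.
Proof.
move=> dF; apply/matrixP => i j.
have E : (fun w => (- F w) i j) = (fun w => - F w i j).
  by apply/funext => w; rewrite mxE.
by rewrite [LHS]dmxE E cderN // [RHS]mxE dmxE.
Qed.

Lemma mdiffB F G z : mdiff F z -> mdiff G z -> mdiff (fun w => F w - G w) z.
Proof. by move=> dF dG; apply: mdiffD => //; exact: mdiffN. Qed.

Lemma dmxB v F G z : mdiff F z -> mdiff G z ->
  dmx v (fun w => F w - G w) z = dmx v F z - dmx v G z.
Proof. by move=> dF dG; rewrite dmxD ?dmxN //; exact: mdiffN. Qed.

Lemma mdiffM F G z : mdiff F z -> mdiff G z -> mdiff (fun w => F w *m G w) z.
Proof.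
move=> dF dG i j; under eq_fun do rewrite mxE.
by apply: cdiff_sum => k; exact: cdiffM.
Qed.

Lemma dmxM v F G z : mdiff F z -> mdiff G z ->
  dmx v (fun w => F w *m G w) z = dmx v F z *m G z + F z *m dmx v G z.
Proof.
move=> dF dG; apply/matrixP => i j; rewrite dmxE [RHS]mxE.
rewrite (_ : (fun w => _) = fun w => \sum_k F w i k * G w k j); last first.
  by apply/funext => w; rewrite mxE.
rewrite cder_sum => [|k]; last exact: cdiffM.
rewrite [X in _ = X + _]mxE [X in _ = _ + X]mxE -big_split /=.
by apply: eq_bigr => k _; rewrite !dmxE cderM.
Qed.

Lemma mdiffZ (a : R[i]) F z : mdiff F z -> mdiff (fun w => a *: F w) z.
Proof.
move=> dF i j; under eq_fun do rewrite mxE.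
by apply: cdiffM => //; exact: cdiff_cst.
Qed.

Lemma dmxZ v (a : R[i]) F z : mdiff F z ->
  dmx v (fun w => a *: F w) z = a *: dmx v F z.
Proof.
move=> dF; apply/matrixP => i j; rewrite dmxE [RHS]mxE dmxE.
rewrite (_ : (fun w => _) = fun w => a * F w i j); last first.
  by apply/funext => w; rewrite mxE.
by rewrite cderM ?cder_cst ?mul0r ?add0r //; exact: cdiff_cst.
Qed.

Lemma mdiff_adj F z : mdiff F z -> mdiff (fun w => (F w) ^t*) z.
Proof.
move=> dF i j; under eq_fun do rewrite !mxE; exact: cdiffJ.
Qed.

Lemma dmx_adj v F z : mdiff F z -> dmx v (fun w => (F w) ^t*) z = (dmx v F z) ^t*.
Proof.
move=> dF; apply/matrixP => i j.
have E : (fun w => (F w) ^t* i j) = (fun w => Num.conj (F w j i)).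
  by apply/funext => w; rewrite mxE mxE.
by rewrite (dmxE v (fun w => (F w) ^t*)) E cderJ // [RHS]mxE [X in _ = Num.conj X]mxE dmxE.
Qed.

Lemma dmx_comm F u v z : (\forall w \near z, mdiff F w) ->
  mdiff (dmx u F) z -> mdiff (dmx v F) z ->
  dmx v (dmx u F) z = dmx u (dmx v F) z.
Proof.
move=> dF du dv; apply/matrixP => i j.
rewrite [LHS]dmxE [RHS]dmxE.
have E x : (fun w => dmx x F w i j) = cder x (fun w => F w i j).
  by apply/funext => w; rewrite dmxE.
rewrite (E u) (E v).
apply: cder_comm; first by apply: filterS dF => w; apply.
- by rewrite -(E u); exact: du.
- by rewrite -(E v); exact: dv.
Qed.

Lemma cdiff_det (m : nat) (F : V -> 'M[R[i]]_m) z :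
  (forall i j, cdiff (fun w => F w i j) z) -> cdiff (fun w => \det (F w)) z.
Proof.
move=> dF; apply: cdiff_sum => s; apply: cdiffM; first exact: cdiff_cst.
by apply: cdiff_prod => i.
Qed.

(** By Cramer's rule the entries of the inverse are quotients of polynomials
    in the entries of F by its determinant. *)
Lemma mdiff_inv F z : (\forall w \near z, F w \in unitmx) ->
  mdiff F z -> mdiff (fun w => invmx (F w)) z.
Proof.
move=> uF dF; apply: (@near_eq_mdiff (fun w => (\det (F w))^-1 *: \adj (F w))).
  by apply: filterS uF => w uw; rewrite /invmx uw.
move=> i j; under eq_fun do rewrite !mxE; apply: cdiffM.
  apply: cdiffV; last exact: cdiff_det.
  by move: (nbhs_singleton uF); rewrite unitmxE unitfE.
apply: cdiffM; first exact: cdiff_cst.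
apply: cdiff_det => k l; under eq_fun do rewrite !mxE; exact: dF.
Qed.

Lemma mulmx_solve (A B X : mat) : A \in unitmx ->
  A *m X = - (B *m invmx A) -> X = - (invmx A *m B *m invmx A).
Proof. by move=> uA E; rewrite -[LHS](mulKmx uA) E mulmxN mulmxA. Qed.

Lemma dmx_inv v F z : (\forall w \near z, F w \in unitmx) -> mdiff F z ->
  dmx v (fun w => invmx (F w)) z = - (invmx (F z) *m dmx v F z *m invmx (F z)).
Proof.
move=> uF dF; have dI := mdiff_inv uF dF; have uz := nbhs_singleton uF.
have : dmx v (fun w => F w *m invmx (F w)) z = 0.
  rewrite -(dmx_cst v 1%:M z); apply: near_eq_dmx.
  by apply: filterS uF => w uw; rewrite mulmxV.
rewrite dmxM // addrC => /eqP; rewrite addr_eq0 => /eqP.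
exact: mulmx_solve.
Qed.

Lemma retrE (A : mat) : retr A = \sum_i complex.Re (A i i).
Proof. by rewrite /retr /mxtrace; elim/big_rec2: _ => // i a b _ <-; rewrite ReD. Qed.

Lemma is_derive_retr F z v : mdiff F z ->
  is_derive z v (fun w => retr (F w)) (retr (dmx v F z)).
Proof.
move=> dF; rewrite (_ : (fun w => _) = \sum_(i < n) (fun w => complex.Re (F w i i))).
  have E i : complex.Re (dmx v F z i i) = 'D_v (fun w => complex.Re (F w i i)) z.
    by rewrite dmxE.
  rewrite retrE (eq_bigr _ (fun i _ => E i)).
  by apply: is_derive_sum => i; apply/derivableP/diff_derivable; case: (dF i i).
by apply/funext => w; rewrite retrE fct_sumE.
Qed.

Lemma differentiable_retr F z : mdiff F z -> differentiable (fun w => retr (F w)) z.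
Proof.
move=> dF; rewrite (_ : (fun w => _) = \sum_(i < n) (fun w => complex.Re (F w i i))).
  by apply: differentiable_sum => i; case: (dF i i).
by apply/funext => w; rewrite retrE fct_sumE.
Qed.

Lemma iter_dmx_rcons (vs : seq V) v F :
  iter_dmx (rcons vs v) F = iter_dmx vs (dmx v F).
Proof. by rewrite /iter_dmx foldr_rcons. Qed.

Lemma eq_iter_dmx (A : set V) F G : open A -> (forall w, A w -> F w = G w) ->
  forall vs w, A w -> iter_dmx vs F w = iter_dmx vs G w.
Proof.
move=> oA FG; elim => [|v vs IH] w Aw /=; first exact: FG.
by apply: near_eq_dmx; apply: filterS (open_nbhs_nbhs (conj oA Aw)) => x /IH.
Qed.

End MatrixCalculus.

(** * Decay classes on space-time *)

Section Classes.
Variables (R : realType) (n : nat).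
Local Notation mat := 'M[R[i]]_n.
Local Notation plane := (R * R)%type.
Local Notation spacetime := (R * (R * R))%type.
Local Notation normc := (@Normc.normc R).
Implicit Types (I : set R) (F G : spacetime -> mat) (k l m : nat).

Definition slab I : set spacetime := [set w | I w.1].

(** The bound is uniform in the time over compact subintervals of I only, as I
    may be unbounded or have a blow-up at its ends. *)
Definition weighted_bound k I F := forall a b : R, [set` `[a, b]] `<=` I ->
  exists B : R, forall t, t \in `[a, b] -> forall z i j,
    (1 + `|z|) ^+ k * normc (F (t, z) i j) <= B.

Definition decay0 k I F := (forall w, I w.1 -> mdiff F w) /\ weighted_bound k I F.

(** Bounding the number of derivatives allows proofs by induction on it: the
    product rule, used once per step, replaces the general Leibniz formula. *)
Definition decayn m k I F :=
  forall vs : seq spacetime, (size vs <= m)%N -> decay0 k I (iter_dmx vs F).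

(** All derivatives are O((1 + |z|)^-k). At k = 0 these are the functions
    bounded with all their derivatives, the multipliers of the rapidly
    decaying ones. *)
Definition decay k I F := forall vs : seq spacetime, decay0 k I (iter_dmx vs F).

Lemma decayP k I F : decay k I F <-> forall m, decayn m k I F.
Proof. by split=> [H m vs _|H vs]; [exact: H|exact: (H (size vs))]. Qed.

Lemma normc_ge0 (x : R[i]) : 0 <= normc x.
Proof. by case: x => a b; exact: sqrtr_ge0. Qed.

Lemma weight_ge0 k (z : plane) : 0 <= (1 + `|z|) ^+ k.
Proof. by rewrite exprn_ge0 // addr_ge0. Qed.

Lemma slab_open I : open I -> open (slab I).
Proof.
move=> oI; have -> : slab I = fst @^-1` I by [].
by apply: open_comp => // w _; exact: cvg_fst.
Qed.

Lemma near_slab I (w : spacetime) : open I -> I w.1 -> \forall x \near w, I x.1.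
Proof. by move=> oI Iw; exact: (open_nbhs_nbhs (conj (slab_open oI) Iw)). Qed.

Lemma eq_decay0 k I F G : open I -> (forall w, I w.1 -> F w = G w) ->
  decay0 k I F -> decay0 k I G.
Proof.
move=> oI FG [dF bF]; split=> [w Iw|a b abI].
  apply: near_eq_mdiff (dF w Iw); apply: filterS (near_slab oI Iw) => x.
  exact: FG.
have [B HB] := bF a b abI; exists B => t tab z i j.
by rewrite -FG; [exact: HB|exact: abI].
Qed.

Lemma eq_decayn m k I F G : open I -> (forall w, I w.1 -> F w = G w) ->
  decayn m k I F -> decayn m k I G.
Proof.
move=> oI FG H vs sv; apply: eq_decay0 (H vs sv) => // w.
exact: (eq_iter_dmx (slab_open oI) FG).
Qed.

Lemma eq_decay k I F G : open I -> (forall w, I w.1 -> F w = G w) ->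
  decay k I F -> decay k I G.
Proof. by move=> oI FG /decayP H; apply/decayP => m; exact: (eq_decayn oI FG). Qed.

Lemma decaynS m k I F :
  decayn m.+1 k I F <-> decay0 k I F /\ forall v, decayn m k I (dmx v F).
Proof.
split=> [H|[H0 H] vs].
  split=> [|v vs sv]; first exact: (H [::]).
  by rewrite -iter_dmx_rcons; apply: H; rewrite size_rcons.
case/lastP: vs => [|vs v]; first by move=> _; exact: H0.
by rewrite size_rcons iter_dmx_rcons; exact: H.
Qed.

Lemma decayn0 k I F : decayn 0 k I F <-> decay0 k I F.
Proof. by split=> [H|H [|v vs] //]; exact: (H [::]). Qed.

Lemma decaynW m k I F : decayn m.+1 k I F -> decayn m k I F.
Proof. by move=> H vs sv; apply: H; exact: leqW. Qed.

Lemma decayn_cls0 m k I F : decayn m k I F -> decay0 k I F.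
Proof. by move=> H; exact: (H [::]). Qed.

Lemma decay_dmx k I F v : decay k I F -> decay k I (dmx v F).
Proof. by move=> H vs; rewrite -iter_dmx_rcons; exact: H. Qed.

Lemma decay0D k I F G : decay0 k I F -> decay0 k I G -> decay0 k I (fun w => F w + G w).
Proof.
move=> [dF bF] [dG bG]; split=> [w Iw|a b abI].
  by apply: mdiffD; [exact: dF|exact: dG].
have [B HB] := bF a b abI; have [B' HB'] := bG a b abI.
exists (B + B') => t tab z i j; rewrite mxE.
apply: le_trans (lerD (HB t tab z i j) (HB' t tab z i j)).
by rewrite -mulrDr ler_wpM2l ?weight_ge0 // le_normcD.
Qed.

Lemma decay0N k I F : decay0 k I F -> decay0 k I (fun w => - F w).
Proof.
move=> [dF bF]; split=> [w Iw|a b abI]; first by apply: mdiffN; exact: dF.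
have [B HB] := bF a b abI.
by exists B => t tab z i j; rewrite mxE normcN; exact: HB.
Qed.

Lemma decay0J k I F : decay0 k I F -> decay0 k I (fun w => (F w) ^t*).
Proof.
move=> [dF bF]; split=> [w Iw|a b abI]; first by apply: mdiff_adj; exact: dF.
have [B HB] := bF a b abI; exists B => t tab z i j.
rewrite mxE mxE (_ : normc _ = normc (F (t, z) j i)); first exact: HB.
by case: (F _ _ _) => x y /=; rewrite sqrrN.
Qed.

Lemma normc_sum (J : Type) (r : seq J) (f : J -> R[i]) :
  normc (\sum_(i <- r) f i) <= \sum_(i <- r) normc (f i).
Proof.
elim: r => [|i r IH]; first by rewrite !big_nil Normc.normc0.
by rewrite !big_cons (le_trans (le_normcD _ _)) // lerD2l.
Qed.

Lemma decay0M k l I F G : decay0 k I F -> decay0 l I G ->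
  decay0 (k + l) I (fun w => F w *m G w).
Proof.
move=> [dF bF] [dG bG]; split=> [w Iw|a b abI].
  by apply: mdiffM; [exact: dF|exact: dG].
have [B HB] := bF a b abI; have [B' HB'] := bG a b abI.
exists (\sum_(i < n) B * B') => t tab z i j; rewrite mxE.
apply: le_trans (ler_wpM2l (weight_ge0 _ _) (normc_sum _ _)) _.
rewrite mulr_sumr; apply: ler_sum => h _; rewrite Normc.normcM exprD mulrACA.
by apply: ler_pM; rewrite ?HB ?HB' // mulr_ge0 ?weight_ge0 ?normc_ge0.
Qed.

Section Closure.
Variable I : set R.
Hypothesis oI : open I.

Lemma decaynD m k F G :
  decayn m k I F -> decayn m k I G -> decayn m k I (fun w => F w + G w).
Proof.
elim: m F G => [F G|m IH F G].
  by rewrite !decayn0; exact: decay0D.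
move=> /decaynS[F0 dF] /decaynS[G0 dG]; apply/decaynS; split; first exact: decay0D.
move=> v; apply: (@eq_decayn _ _ _ (fun w => dmx v F w + dmx v G w)) => //.
  by move=> w Iw; rewrite dmxD //; [exact: (F0.1)|exact: (G0.1)].
by apply: IH; [exact: dF|exact: dG].
Qed.

Lemma decaynN m k F : decayn m k I F -> decayn m k I (fun w => - F w).
Proof.
elim: m F => [F|m IH F].
  by rewrite !decayn0; exact: decay0N.
move=> /decaynS[F0 dF]; apply/decaynS; split; first exact: decay0N.
move=> v; apply: (@eq_decayn _ _ _ (fun w => - dmx v F w)) => //.
  by move=> w Iw; rewrite dmxN //; exact: (F0.1).
by apply: IH; exact: dF.
Qed.

Lemma decaynJ m k F : decayn m k I F -> decayn m k I (fun w => (F w) ^t*).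
Proof.
elim: m F => [F|m IH F].
  by rewrite !decayn0; exact: decay0J.
move=> /decaynS[F0 dF]; apply/decaynS; split; first exact: decay0J.
move=> v; apply: (@eq_decayn _ _ _ (fun w => (dmx v F w) ^t*)) => //.
  by move=> w Iw; rewrite dmx_adj //; exact: (F0.1).
by apply: IH; exact: dF.
Qed.

Lemma decaynM m k l F G : decayn m k I F -> decayn m l I G ->
  decayn m (k + l) I (fun w => F w *m G w).
Proof.
elim: m F G => [F G|m IH F G].
  by rewrite !decayn0; exact: decay0M.
move=> FS GS; have /decaynS[F0 dF] := FS; have /decaynS[G0 dG] := GS.
apply/decaynS; split; first exact: decay0M.
move=> v; apply: (@eq_decayn _ _ _ (fun w => dmx v F w *m G w + F w *m dmx v G w)) => //.
  by move=> w Iw; rewrite dmxM //; [exact: (F0.1)|exact: (G0.1)].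
by apply: decaynD; apply: IH => //; exact: decaynW.
Qed.

Lemma decayD k F G : decay k I F -> decay k I G -> decay k I (fun w => F w + G w).
Proof. by move=> /decayP H /decayP H'; apply/decayP => m; exact: decaynD. Qed.

Lemma decayN k F : decay k I F -> decay k I (fun w => - F w).
Proof. by move=> /decayP H; apply/decayP => m; exact: decaynN. Qed.

Lemma decayJ k F : decay k I F -> decay k I (fun w => (F w) ^t*).
Proof. by move=> /decayP H; apply/decayP => m; exact: decaynJ. Qed.

Lemma decayM k l F G : decay k I F -> decay l I G -> decay (k + l) I (fun w => F w *m G w).
Proof. by move=> /decayP H /decayP H'; apply/decayP => m; exact: decaynM. Qed.

(** A bound on the inverse alone propagates to all its derivatives, because d
    (F^-1) = - F^-1 dF F^-1 involves only F^-1 and derivatives of F. *)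
Lemma decay_inv F : decay 0 I F -> (forall w, I w.1 -> F w \in unitmx) ->
  weighted_bound 0 I (fun w => invmx (F w)) -> decay 0 I (fun w => invmx (F w)).
Proof.
move=> /decayP H uF bI.
have nu (w : spacetime) : I w.1 -> \forall x \near w, F x \in unitmx.
  by move=> Iw; apply: filterS (near_slab oI Iw) => x; exact: uF.
have C0 : decay0 0 I (fun w => invmx (F w)).
  by split=> // w Iw; apply: mdiff_inv; [exact: nu|exact: (decayn_cls0 (H 0%N)).1].
apply/decayP; elim => [|m IH]; first by rewrite decayn0.
apply/decaynS; split=> // v.
apply: (@eq_decayn _ _ _ (fun w => - (invmx (F w) *m dmx v F w *m invmx (F w)))) => //.
  by move=> w Iw; rewrite dmx_inv //; [exact: nu|exact: (decayn_cls0 (H 0%N)).1].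
have /decaynS[_ dF] := H m.+1.
by apply: decaynN; apply: (@decaynM _ 0 0) => //; exact: (@decaynM _ 0 0).
Qed.
End Closure.

Lemma iter_dmx_cst (vs : seq spacetime) (A : mat) : iter_dmx vs (fun=> A) = fun=>
  (if vs is [::] then A else 0).
Proof.
elim: vs => // v vs IH; apply/funext => w /=.
by rewrite IH; case: vs {IH} => [|u vs]; exact: dmx_cst.
Qed.

Lemma decay_cst I (A : mat) : decay 0 I (fun=> A).
Proof.
move=> vs; rewrite iter_dmx_cst; set A' := match vs with [::] => _ | _ => _ end; move: A' => {}A.
split=> [w _|a b _]; first exact: mdiff_cst.
exists (\sum_i \sum_j normc (A i j)) => t _ z i j; rewrite expr0 mul1r.
rewrite (bigD1 i) //= (bigD1 j) //= -addrA lerDl addr_ge0 ?sumr_ge0 // => *.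
  exact: normc_ge0.
by apply: sumr_ge0 => *; exact: normc_ge0.
Qed.

Lemma decay_sub k I J F : J `<=` I -> decay k I F -> decay k J F.
Proof.
move=> JI H vs; have [dF bF] := H vs; split=> [w /JI|a b abJ]; first exact: dF.
by apply: bF; exact: subset_trans JI.
Qed.

Definition rapid I F := forall k, decay k I F.

Lemma rapidly_decaying_curveP I (F : R -> plane -> mat) :
  rapidly_decaying_curve I F <-> rapid I (joint F).
Proof.
split=> [[sF bF] k vs|H].
  split=> [w Iw i j|a b abI]; first exact: sF.
  exact: bF.
split=> [vs i j z Iz|a b abI vs k].
  by have [dF _] := H 0%N vs; exact: dF.
by have [_ bF] := H k vs; exact: bF.
Qed.

Section RapidDecay.
Variable I : set R.
Hypothesis oI : open I.

Lemma rapid_bounded F : rapid I F -> decay 0 I F. Proof. by move=> H; exact: H. Qed.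

Lemma eq_rapid F G : (forall w, I w.1 -> F w = G w) -> rapid I F -> rapid I G.
Proof. by move=> FG H k; exact: eq_decay (H k). Qed.

Lemma rapidD F G : rapid I F -> rapid I G -> rapid I (fun w => F w + G w).
Proof. by move=> H H' k; exact: decayD. Qed.

Lemma rapidN F : rapid I F -> rapid I (fun w => - F w).
Proof. by move=> H k; exact: decayN. Qed.

Lemma rapidB F G : rapid I F -> rapid I G -> rapid I (fun w => F w - G w).
Proof. by move=> H H'; apply: rapidD => //; exact: rapidN. Qed.

Lemma rapidJ F : rapid I F -> rapid I (fun w => (F w) ^t*).
Proof. by move=> H k; exact: decayJ. Qed.

(** The second factor need only be bounded with its derivatives: this is how
    the unitary functions, which tend to 1 at infinity, enter. *)
Lemma rapidMl F G : rapid I F -> decay 0 I G -> rapid I (fun w => F w *m G w).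
Proof. by move=> H H' k; rewrite -[k]addn0; exact: decayM. Qed.

Lemma rapidMr F G : decay 0 I F -> rapid I G -> rapid I (fun w => F w *m G w).
Proof. by move=> H H' k; rewrite -[k]add0n; exact: decayM. Qed.

Lemma rapidZ (a : R[i]) F : rapid I F -> rapid I (fun w => a *: F w).
Proof.
move=> H; apply: (@eq_rapid (fun w => a%:M *m F w)).
  by move=> w _; rewrite mul_scalar_mx.
by apply: rapidMr => //; exact: decay_cst.
Qed.

Lemma rapid_dmx F v : rapid I F -> rapid I (dmx v F).
Proof. by move=> H k; exact: decay_dmx. Qed.

Lemma rapid_comm F G : rapid I F -> rapid I G -> rapid I (fun w => commx (F w) (G w)).
Proof.
by move=> H H'; apply: rapidB; apply: rapidMl => //; exact: rapid_bounded.
Qed.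

Lemma decay_mdiff k F : decay k I F -> forall w, I w.1 -> mdiff F w.
Proof. by move=> H; have [] := H [::]. Qed.

Lemma decay_dmx_comm k F u v w : decay k I F -> I w.1 ->
  dmx v (dmx u F) w = dmx u (dmx v F) w.
Proof.
move=> H Iw; apply: dmx_comm.
- by apply: filterS (near_slab oI Iw) => x; exact: decay_mdiff H _.
- by apply: (decay_mdiff (decay_dmx u H)).
- by apply: (decay_mdiff (decay_dmx v H)).
Qed.
End RapidDecay.

Lemma derive_slice (W : normedModType R) (f : spacetime -> W) (t : R) (v z : plane) :
  'D_(0, v) f (t, z) = 'D_v (fun x => f (t, x)) z.
Proof.
have E : (fun h : R => h^-1 *: ((f \o shift (t, z)) (h *: ((0, v) : spacetime)) - f (t, z)))
    = (fun h : R => h^-1 *: (((fun x => f (t, x)) \o shift z) (h *: v) - f (t, z))).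
  apply/funext => h /=; congr (_ *: (f _ - _)).
  by apply/pair_equal_spec; split => //=; rewrite scaler0 add0r.
by rewrite /derive E.
Qed.

Lemma dmx_snd (f : plane -> mat) (v w : spacetime) :
  dmx v (fun x => f x.2) w = dmx v.2 f w.2.
Proof. by []. Qed.

Lemma dmx_slice F (t : R) (v z : plane) :
  dmx (0, v) F (t, z) = dmx v (fun x => F (t, x)) z.
Proof.
apply/matrixP => i j; rewrite [LHS]dmxE [RHS]dmxE.
exact: (congr2 (@Complex R) (derive_slice (fun w => complex.Re (F w i j)) t v z)
  (derive_slice (fun w => complex.Im (F w i j)) t v z)).
Qed.

Lemma iter_dmx_snd (f : plane -> mat) (vs : seq spacetime) :
  iter_dmx vs (fun x => f x.2) = fun w => iter_dmx (map snd vs) f w.2.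
Proof. by elim: vs => // v vs /= ->; apply/funext => w; exact: dmx_snd. Qed.

Lemma iter_dmx_slice F (t : R) (vs : seq plane) :
  iter_dmx vs (fun x => F (t, x)) =
  fun z => iter_dmx (map (pair 0) vs) F (t, z).
Proof.
by elim: vs => // v vs /= ->; apply/funext => z; rewrite dmx_slice.
Qed.

(** A function on the plane is handled as a curve that is constant in time. *)
Lemma rapidly_decayingP (f : plane -> mat) :
  rapidly_decaying f <-> rapid setT (fun w => f w.2).
Proof.
split=> [[sf bf] k vs|H].
  rewrite iter_dmx_snd; split=> [w _ i j|a b _].
    have [d1 d2] := sf (map snd vs) i j w.2 Logic.I.
    have ds : differentiable (snd : spacetime -> plane) w.
      by apply: linear_differentiable => x; exact: cvg_snd.
    by split; [exact: (differentiable_comp ds d1)|exact: (differentiable_comp ds d2)].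
  have [B HB] := bf (map snd vs) k; exists B => t _ z i j; exact: HB.
have S (vs : seq plane) : iter_dmx vs f =
    fun z => iter_dmx (map (pair 0) vs) (fun w : spacetime => f w.2) (0, z).
  exact: (iter_dmx_slice (fun w : spacetime => f w.2) 0 vs).
split=> [vs i j z _|vs k].
  rewrite S.
  have [d _] := H 0%N (map (pair 0) vs); have [d1 d2] := d (0, z) Logic.I i j.
  have ds : differentiable (fun x : plane => (0 : R, x)) z.
    by apply: differentiable_pair => //; exact: differentiable_cst.
  by split; [exact: (differentiable_comp ds d1)|exact: (differentiable_comp ds d2)].
rewrite S; have [_ b] := H k (map (pair 0) vs).
have [|B HB] := b 0 0; first by [].
by exists B => z i j; apply: HB; rewrite in_itv /= lexx.
Qed.

Lemma rapid_slice I F t : I t -> rapid I F -> rapidly_decaying (fun z => F (t, z)).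
Proof.
move=> It H; split=> [vs i j z _|vs k]; rewrite iter_dmx_slice.
  have [d _] := H 0%N (map (pair 0) vs); have [d1 d2] := d (t, z) It i j.
  have ds : differentiable (fun x : plane => (t : R, x)) z.
    by apply: differentiable_pair => //; exact: differentiable_cst.
  by split; [exact: (differentiable_comp ds d1)|exact: (differentiable_comp ds d2)].
have [_ b] := H k (map (pair 0) vs).
have [|B HB] := b t t; first by move=> x /=; rewrite in_itv /= -eq_le => /eqP <-.
by exists B => z i j; apply: HB; rewrite in_itv /= lexx.
Qed.

End Classes.

(** * Integration over the plane *)

Section PlaneIntegral.
Variable R : realType.
Local Notation plane := (R * R)%type.
Local Notation mu := (@lebesgue_measure R).

(** An open set is the union of the countably many squares with rational
    centre and radius 1/(N+1) that it contains. *)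
Lemma open_measurable_plane (U : set plane) : open U -> measurable U.
Proof.
move=> oU.
pose box (i : rat * rat * nat) : set plane :=
  ball (ratr i.1.1 : R) (i.2.+1%:R^-1) `*` ball (ratr i.1.2 : R) (i.2.+1%:R^-1).
pose F i := if `[< box i `<=` U >] then box i else set0.
have -> : U = \bigcup_i F i.
  apply/seteqP; split=> [z Uz|z [i _]]; last first.
    by rewrite /F; case: asboolP => // + Bz; exact.
  have /nbhs_ballP[e /= e0 eU] := open_nbhs_nbhs (conj oU Uz).
  have [N _ /(_ _ (leqnn N)) HN] := near_infty_natSinv_lt (PosNum (divr_gt0 e0 (ltr0n R 2))).
  have {HN} HN : N.+1%:R^-1 < e / 2 by [].
  have N0 : 0 < N.+1%:R^-1 :> R by rewrite invr_gt0.
  have W (x : R) : x - N.+1%:R^-1 < x + N.+1%:R^-1.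
    by rewrite ltrBlDr -addrA ltrDl addr_gt0.
  have [a] := rat_in_itvoo (W z.1); have [b] := rat_in_itvoo (W z.2).
  have [c Ec] : exists c : R, c = N.+1%:R^-1 by exists N.+1%:R^-1.
  rewrite -Ec in HN N0 *.
  rewrite !in_itv /= => /andP[b1 b2] /andP[a1 a2].
  exists (a, b, N) => //; rewrite /F /box /= -Ec {W}; case: asboolP => [_|[]].
    by split; rewrite /ball /= ltr_norml; apply/andP; split; lra.
  move=> w [/=]; rewrite /ball /= !ltr_norml => /andP[w1 w2] /andP[w3 w4].
  apply: eU; split; rewrite /ball /= ltr_norml; apply/andP; split; lra.
apply: countable_bigcupT_measurable; first exact: countableP.
move=> i; rewrite /F; case: ifP => // _.
by apply: measurableX; exact: measurable_ball.
Qed.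

Lemma continuous_measurable_plane (f : plane -> R) :
  continuous f -> measurable_fun setT f.
Proof.
move=> /continuousP cf; apply: (measurability _ (RGenOpens.measurableE R)).
move=> _ [_ [a [b ->] <-]]; rewrite setTI; apply: open_measurable_plane.
exact/cf/interval_open.
Qed.

(** An integrable majorant for functions that decay like |z|^-4, chosen as a
    product so that Tonelli's theorem computes its integral. *)
Definition cauchy_weight (z : plane) : R := (oneDsqr z.1)^-1 * (oneDsqr z.2)^-1.

Lemma continuous_cauchy_weight : continuous cauchy_weight.
Proof.
move=> z; apply: cvgM.
- apply: (@continuous_comp _ _ _ fst (fun x : R => (oneDsqr x)^-1)).
    exact: cvg_fst.
  exact: continuous_oneDsqrV.
- apply: (@continuous_comp _ _ _ snd (fun x : R => (oneDsqr x)^-1)).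
    exact: cvg_snd.
  exact: continuous_oneDsqrV.
Qed.

Lemma cauchy_weight_ge0 z : 0 <= cauchy_weight z.
Proof. by rewrite mulr_ge0 // invr_ge0. Qed.

Lemma integral_oneDsqrV : (\int[mu]_x (oneDsqr x)^-1%:E = (pi : R)%:E)%E.
Proof.
rewrite ge0_symfun_integralT.
- rewrite (_ : [set x : R | _] = `[0, +oo[%classic); last first.
    by apply/seteqP; split => x /=; rewrite in_itv /= andbT.
  by rewrite integral0y_oneDsqr -EFinM mulrC divfK.
- by move=> x; rewrite invr_ge0.
- exact: continuous_oneDsqrV.
- by move=> x; rewrite /= /oneDsqr sqrrN.
Qed.

Lemma integrable_cauchy_weight : (mu \x mu)%E.-integrable setT (EFin \o cauchy_weight).
Proof.
apply/integrable12ltyP.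
  apply/measurable_EFinP; apply: continuous_measurable_plane.
  exact: continuous_cauchy_weight.
have E x : (\int[mu]_y `|(EFin \o cauchy_weight) (x, y)| = (pi : R)%:E * ((oneDsqr x)^-1)%:E)%E.
  transitivity (\int[mu]_y (((oneDsqr x)^-1)%:E * ((oneDsqr y)^-1)%:E))%E.
    by apply: eq_integral => y _; rewrite -EFinM /= ger0_norm // cauchy_weight_ge0.
  rewrite ge0_integralZl //; first by rewrite integral_oneDsqrV muleC.
  by apply/measurable_EFinP; apply: continuous_measurable_fun; exact: continuous_oneDsqrV.
rewrite (_ : (\int[mu]_x _)%E = (\int[mu]_x ((pi : R)%:E * ((oneDsqr x)^-1)%:E))%E); last first.
  by apply: eq_integral => x _; exact: E.
rewrite ge0_integralZl ?integral_oneDsqrV ?ltry //.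
- by apply/measurable_EFinP; apply: continuous_measurable_fun; exact: continuous_oneDsqrV.
- by rewrite lee_fin pi_ge0.
Qed.

(** The exponent 4 is what (1 + x^2) (1 + y^2) <= (1 + |z|)^4 costs, the norm
    of the plane being the maximum norm. *)
Lemma weight4_le (z : plane) (x B : R) : 0 <= x -> (1 + `|z|) ^+ 4 * x <= B ->
  x <= B * cauchy_weight z.
Proof.
move=> x0 H.
have N1 : `|z.1| <= `|z| by rewrite prod_normE le_max lexx.
have N2 : `|z.2| <= `|z| by rewrite prod_normE le_max lexx orbT.
have W (a : R) : `|a| <= `|z| -> oneDsqr a <= (1 + `|z|) ^+ 2.
  move=> az; rewrite /oneDsqr -real_normK ?num_real //.
  have := normr_ge0 a; nra.
have p1 : 0 < oneDsqr z.1 by rewrite (lt_le_trans ltr01) // oneDsqr_ge1.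
have p2 : 0 < oneDsqr z.2 by rewrite (lt_le_trans ltr01) // oneDsqr_ge1.
rewrite /cauchy_weight -invfM ler_pdivlMr ?mulr_gt0 //.
apply: le_trans H; rewrite mulrC ler_wpM2r //.
rewrite (_ : 4 = 2 + 2)%N // exprD.
by apply: ler_pM; rewrite ?(ltW p1) ?(ltW p2) ?W.
Qed.

Lemma integrable_decay (f : plane -> R) (B : R) : continuous f ->
  (forall z, (1 + `|z|) ^+ 4 * `|f z| <= B) ->
  (mu \x mu)%E.-integrable setT (EFin \o f).
Proof.
move=> cf fB.
have B0 : 0 <= B.
  apply: le_trans (fB 0); by rewrite mulr_ge0 // exprn_ge0 // addr_ge0.
apply: (le_integrable _ _ _ (integrableZl _ B integrable_cauchy_weight)) => //.
  by apply/measurable_EFinP; apply: continuous_measurable_plane.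
move=> z _ /=; rewrite lee_fin [X in _ <= X]ger0_norm.
  exact: weight4_le.
by rewrite mulr_ge0 // cauchy_weight_ge0.
Qed.

(** A positive value of f would persist, halved, on a square, whose measure is
    positive. *)
Lemma integral_plane_eq0 (f : plane -> R) (z : plane) : continuous f ->
  (mu \x mu)%E.-integrable setT (EFin \o f) -> (forall x, 0 <= f x) ->
  integral_plane f = 0 -> f z = 0.
Proof.
move=> cf intf f0 If; apply/eqP; apply: contraPT If => fz /eqP; apply/negP.
have {}fz : 0 < f z by rewrite lt_neqAle eq_sym fz f0.
have E : \forall x \near z, f z / 2 < f x.
  apply: (cvgr_gt _ (cf z)); by rewrite ltr_pdivrMr // ltr_pMr // ltr1n.
have /nbhs_ballP[e /= e0 eE] := E.
pose A : set plane := ball z.1 e `*` ball z.2 e.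
have mA : measurable A by apply: measurableX; exact: measurable_ball.
have hA : ((mu \x mu) A = (e *+ 2 * (e *+ 2))%:E)%E.
  transitivity (mu (ball z.1 e : set R) * mu (ball z.2 e : set R))%E.
    by apply: product_measure1E; exact: measurable_ball.
  by rewrite !lebesgue_measure_ball ?(ltW e0) // -!EFinM.
have I0 : ((f z / 2 * (e *+ 2 * (e *+ 2)))%:E <= \int[(mu \x mu)%E]_x (f x)%:E)%E.
  apply: (@le_trans _ _ (\int[(mu \x mu)%E]_(x in A) (f x)%:E)%E); last first.
    apply: ge0_subset_integral => //.
      by apply/measurable_EFinP; apply: continuous_measurable_plane.
    by move=> x _; rewrite lee_fin.
  apply: (@le_trans _ _ (\int[(mu \x mu)%E]_(x in A) (f z / 2)%:E)%E).
    by rewrite integral_cst // -[X in (_ <= _ * X)%E]/((mu \x mu)%E A) hA -EFinM.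
  apply: ge0_le_integral => //.
  - by move=> x _; rewrite lee_fin divr_ge0.
  - by apply: measurable_funTS; apply/measurable_EFinP; apply: continuous_measurable_plane.
  - by move=> x [x1 x2]; rewrite lee_fin ltW //; exact: eE.
rewrite gt_eqF // /integral_plane /Rintegral fine_gt0 //.
apply/andP; split.
  apply: lt_le_trans I0; rewrite lte_fin !mulr_gt0 // ?divr_gt0 //.
    by rewrite mulrn_wgt0.
  by rewrite mulrn_wgt0.
have := integrable_fin_num measurableT intf.
by rewrite ge0_fin_numE ?integral_ge0 // => x _; rewrite lee_fin.
Qed.

End PlaneIntegral.

(** * Integrals of derivatives *)

Section LineIntegral.
Variable R : realType.
Local Notation mu := (@lebesgue_measure R).

Lemma le_oneDsqrV (x B y : R) : (1 + `|x|) ^+ 2 * y <= B -> 0 <= y ->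
  y <= B * (oneDsqr x)^-1.
Proof.
move=> H y0.
have p1 : 0 < oneDsqr x by rewrite (lt_le_trans ltr01) // oneDsqr_ge1.
rewrite ler_pdivlMr // mulrC; apply: le_trans H; rewrite ler_wpM2r //.
rewrite /oneDsqr -real_normK ?num_real //; have := normr_ge0 x; nra.
Qed.

(** On [-k, k] the integral is g(k) - g(-k), which tends to 0; dominated
    convergence lets k tend to infinity. *)
Lemma integral_derive_line (g g' : R -> R) (B : R) :
  (forall x : R, is_derive x (1 : R) g (g' x)) -> continuous g' ->
  (forall x, (1 + `|x|) ^+ 2 * `|g' x| <= B) ->
  (forall x, (1 + `|x|) * `|g x| <= B) ->
  (\int[mu]_x (g' x)%:E = 0)%E.
Proof.
move=> dg cg' Bg' Bg.
pose D (k : nat) : set R := `[- (k.+1%:R : R), k.+1%:R]%classic.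
pose f_ (k : nat) : R -> \bar R := (fun x => (g' x)%:E) \_ (D k).
have mg' : measurable_fun [set: measurableTypeR R] (fun x => (g' x)%:E).
  by apply/measurable_EFinP; exact: continuous_measurable_fun.
have mf_ k : measurable_fun [set: measurableTypeR R] (f_ k).
  apply/(measurable_restrictT _ _).1; first exact: measurable_itv.
  exact: measurable_funTS.
have f_cvg x : f_ ^~ x k @[k --> \oo] --> (g' x)%:E.
  apply: cvg_near_cst.
  have [N HN] : exists N : nat, `|x| <= N%:R.
    by exists (Num.truncn `|x|).+1; rewrite ltW // truncnS_gt.
  exists N => // k /= Nk; rewrite /f_ patchE ifT // inE /D /= in_itv /= -ler_norml.
  by rewrite (le_trans HN) // ler_nat (leq_trans Nk).
have ig : mu.-integrable setT (fun x => (B * (oneDsqr x)^-1)%:E).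
  rewrite (_ : (fun x => _) = (fun x => B%:E * ((oneDsqr x)^-1)%:E)%E) //.
  apply: integrableZl => //; apply/integrableP; split.
    by apply/measurable_EFinP; apply: continuous_measurable_fun; exact: continuous_oneDsqrV.
  rewrite (_ : (\int[mu]_x _)%E = (\int[mu]_x ((oneDsqr x)^-1)%:E)%E).
    by rewrite integral_oneDsqrV ltry.
  by apply: eq_integral => x _; rewrite /= ger0_norm // invr_ge0.
have fg k x : (`|f_ k x| <= (B * (oneDsqr x)^-1)%:E)%E.
  have H := le_oneDsqrV (Bg' x) (normr_ge0 _).
  rewrite /f_ patchE; case: ifP => _; first by rewrite lee_fin.
  by rewrite abse0 lee_fin (le_trans _ H).
have [||_ _ L] := dominated_convergence measurableT mf_ mg' _ ig.
- by apply: aeW => x _; exact: f_cvg.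
- by apply: aeW => x k _; exact: fg.
apply: (cvg_unique _ L) => //.
have E k : (\int[mu]_x f_ k x = (g k.+1%:R - g (- k.+1%:R))%:E)%E.
  rewrite -integral_mkcond EFinB; apply: continuous_FTC2.
  - by rewrite (@lt_trans _ _ 0) ?oppr_lt0 ?ltr0n.
  - exact: continuous_subspaceT.
  - have cg : continuous g.
      by move=> x; apply/differentiable_continuous/derivable1_diffP.
    split => [x _||]; first by [].
    + by apply: cvg_at_right_filter; exact: cg.
    + by apply: cvg_at_left_filter; exact: cg.
  - by move=> x _; rewrite derive1E; exact: derive_val.
rewrite (_ : [sequence _]_n = fun k => (g k.+1%:R - g (- k.+1%:R))%:E); last first.
  by apply/funext => k; exact: E.
apply/cvg_EFin; first exact: nearW.
apply/cvgr0Pnorm_le => e e0.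
exists (Num.truncn (2 * B / e)).+1 => // k /= Nk.
have Bk : B <= e / 2 * (1 + k.+1%:R).
  have : 2 * B / e < k.+1%:R.
    by apply: lt_le_trans (truncnS_gt _) _; rewrite ler_nat (leq_trans Nk).
  rewrite ltr_pdivrMr // => H; lra.
have small x : `|x| = k.+1%:R -> `|g x| <= e / 2.
  move=> xk; have := Bg x; rewrite xk => /le_trans/(_ Bk).
  by rewrite mulrC ler_pM2r // addr_gt0 // ltr0n.
apply: le_trans (ler_normB _ _) _; rewrite [leRHS]splitr.
by apply: lerD; apply: small; rewrite ?normrN ger0_norm.
Qed.
End LineIntegral.

Section Flux.
Variable R : realType.
Local Notation plane := (R * R)%type.
Local Notation mu := (@lebesgue_measure R).

Lemma decay_weaken (z : plane) (k l : nat) (a B y : R) :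
  (l <= k)%N -> `|a| <= `|z| -> 0 <= y ->
  (1 + `|z|) ^+ k * y <= B -> (1 + `|a|) ^+ l * y <= B.
Proof.
move=> lk az y0; apply: le_trans; rewrite ler_wpM2r //.
apply: (@le_trans _ _ ((1 + `|z|) ^+ l)).
  by apply: lerXn2r; rewrite ?nnegrE ?addr_ge0 // lerD2l.
by rewrite ler_weXn2l // lerDl.
Qed.

(** By Fubini's theorem the integral may be taken along the direction of the
    derivative first. *)
Lemma integral_plane_derive_x (f : plane -> R) (B : R) :
  (forall z, derivable f z (dir_x R)) -> continuous ('D_(dir_x R) f) ->
  (forall z, (1 + `|z|) ^+ 4 * `|'D_(dir_x R) f z| <= B) ->
  (forall z, (1 + `|z|) ^+ 4 * `|f z| <= B) ->
  integral_plane ('D_(dir_x R) f) = 0.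
Proof.
move=> df cdf Bdf Bf.
rewrite /integral_plane /Rintegral -integral21_prod_meas1; last first.
  exact: (integrable_decay cdf Bdf).
rewrite (_ : (\int[mu]_x _)%E = 0%E) //.
apply: integral0_eq => y _; rewrite /fubini_G /=.
have E (x : R) : (x, y) = x *: dir_x R + (0, y) :> plane.
  by apply/pair_equal_spec; split => /=; rewrite ?addr0 ?scaler0 ?add0r // [RHS]mulr1.
apply: (@integral_derive_line R (fun x => f (x, y)) (fun x => 'D_(dir_x R) f (x, y)) B).
- move=> x; rewrite (_ : (fun x => f (x, y)) = fun x => f (x *: dir_x R + (0, y))).
    by rewrite E; apply: is_derive_line; exact: df.
  by apply/funext => x'; rewrite E.
- move=> x; apply: (@continuous_comp _ _ _ (fun x => (x, y)) ('D_(dir_x R) f)).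
    apply: differentiable_continuous.
    by apply: differentiable_pair => //; exact: differentiable_cst.
  exact: cdf.
- move=> x; apply: (decay_weaken (z := (x, y)) (k := 4) (l := 2) _ _ _ (Bdf (x, y))) => //.
  by rewrite prod_normE le_max lexx.
- move=> x; rewrite -[1 + `|x|]expr1.
  apply: (decay_weaken (z := (x, y)) (k := 4) (l := 1) _ _ _ (Bf (x, y))) => //.
  by rewrite prod_normE le_max lexx.
Qed.

Lemma integral_plane_derive_y (f : plane -> R) (B : R) :
  (forall z, derivable f z (dir_y R)) -> continuous ('D_(dir_y R) f) ->
  (forall z, (1 + `|z|) ^+ 4 * `|'D_(dir_y R) f z| <= B) ->
  (forall z, (1 + `|z|) ^+ 4 * `|f z| <= B) ->
  integral_plane ('D_(dir_y R) f) = 0.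
Proof.
move=> df cdf Bdf Bf.
rewrite /integral_plane /Rintegral -integral12_prod_meas1; last first.
  exact: (integrable_decay cdf Bdf).
rewrite (_ : (\int[mu]_x _)%E = 0%E) //.
apply: integral0_eq => x _; rewrite /fubini_F /=.
have E (y : R) : (x, y) = y *: dir_y R + (x, 0) :> plane.
  by apply/pair_equal_spec; split => /=; rewrite ?addr0 ?scaler0 ?add0r // [RHS]mulr1.
apply: (@integral_derive_line R (fun y => f (x, y)) (fun y => 'D_(dir_y R) f (x, y)) B).
- move=> y; rewrite (_ : (fun y => f (x, y)) = fun y => f (y *: dir_y R + (x, 0))).
    by rewrite E; apply: is_derive_line; exact: df.
  by apply/funext => x'; rewrite E.
- move=> y; apply: (@continuous_comp _ _ _ (fun y => (x, y)) ('D_(dir_y R) f)).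
    apply: differentiable_continuous.
    by apply: differentiable_pair => //; exact: differentiable_cst.
  exact: cdf.
- move=> y; apply: (decay_weaken (z := (x, y)) (k := 4) (l := 2) _ _ _ (Bdf (x, y))) => //.
  by rewrite prod_normE le_max lexx orbT.
- move=> y; rewrite -[1 + `|y|]expr1.
  apply: (decay_weaken (z := (x, y)) (k := 4) (l := 1) _ _ _ (Bf (x, y))) => //.
  by rewrite prod_normE le_max lexx orbT.
Qed.
End Flux.

(** * Integrals of traces and their time derivatives *)

Section TraceIntegral.
Variables (R : realType) (n : nat).
Local Notation mat := 'M[R[i]]_n.
Local Notation plane := (R * R)%type.
Local Notation spacetime := (R * (R * R))%type.
Local Notation mu := (@lebesgue_measure R).
Variable I : set R.
Hypothesis oI : open I.
Implicit Types (F G : spacetime -> mat) (t : R).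

(** All the forms and functionals at hand are of this type along a curve: the
    pairing of A and B is trint of their product. *)
Definition trint F t : R := integral_plane (fun z => retr (F (t, z))).

Lemma normr_retr (A : mat) : `|retr A| <= \sum_i Normc.normc (A i i).
Proof.
rewrite retrE; apply: le_trans (ler_norm_sum _ _ _) _.
apply: ler_sum => i _; case: (A i i) => a b /=.
by rewrite -sqrtr_sqr ler_wsqrtr // lerDl sqr_ge0.
Qed.

(** Uniformity in the time provides the majorant needed to differentiate under
    the integral sign. *)
Lemma rapid_retr_bound F (a b : R) : rapid I F -> [set` `[a, b]] `<=` I -> forall k,
  exists B, forall t, t \in `[a, b] -> forall z, (1 + `|z|) ^+ k * `|retr (F (t, z))| <= B.
Proof.
move=> H abI k; have [_ bF] := H k [::]; have [B HB] := bF a b abI.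
exists (\sum_(i < n) B) => t tab z.
apply: le_trans (ler_wpM2l (weight_ge0 _ _) (normr_retr _)) _.
by rewrite mulr_sumr; apply: ler_sum => i _; exact: HB.
Qed.

Lemma set_itv1_sub t : I t -> [set` `[t, t]] `<=` I.
Proof. by move=> It x /=; rewrite in_itv /= -eq_le => /eqP <-. Qed.

Lemma rapid_retr_bound1 F t k : rapid I F -> I t ->
  exists B, forall z, (1 + `|z|) ^+ k * `|retr (F (t, z))| <= B.
Proof.
move=> H It; have [B HB] := rapid_retr_bound H (set_itv1_sub It) k.
by exists B => z; apply: HB; rewrite in_itv /= lexx.
Qed.

Lemma differentiable_retr_slice F t z : rapid I F -> I t ->
  differentiable (fun x => retr (F (t, x))) z.
Proof.
move=> H It.
have ds : differentiable (fun x : plane => (t : R, x)) z.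
  by apply: differentiable_pair => //; exact: differentiable_cst.
have dF := @differentiable_retr _ _ _ F (t, z) (decay_mdiff (w := (t, z)) (H 0%N) It).
exact: (differentiable_comp ds dF).
Qed.

Lemma continuous_retr_slice F t : rapid I F -> I t ->
  continuous (fun z => retr (F (t, z))).
Proof.
by move=> H It z; apply: differentiable_continuous; exact: differentiable_retr_slice.
Qed.

Lemma integrable_retr F t : rapid I F -> I t ->
  (mu \x mu)%E.-integrable setT (EFin \o (fun z => retr (F (t, z)))).
Proof.
move=> H It; have [B HB] := rapid_retr_bound1 4 H It.
exact: (integrable_decay (continuous_retr_slice H It) HB).
Qed.

Lemma retrD (A B : mat) : retr (A + B) = retr A + retr B.
Proof. by rewrite /retr raddfD /= ReD. Qed.

Lemma retrN (A : mat) : retr (- A) = - retr A.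
Proof. by rewrite /retr raddfN /= ReN. Qed.

Lemma retrB (A B : mat) : retr (A - B) = retr A - retr B.
Proof. by rewrite retrD retrN. Qed.

Lemma retrC (A B : mat) : retr (A *m B) = retr (B *m A).
Proof. by rewrite /retr mxtrace_mulC. Qed.

Lemma retrZ (a : R) (A : mat) : retr (a%:C *: A) = a * retr A.
Proof. by rewrite /retr linearZ /= ReM /= mul0r subr0. Qed.

Lemma eq_trint F G t : (forall z, retr (F (t, z)) = retr (G (t, z))) ->
  trint F t = trint G t.
Proof. by move=> FG; congr integral_plane; apply/funext. Qed.

Lemma trintD F G t : rapid I F -> rapid I G -> I t ->
  trint (fun w => F w + G w) t = trint F t + trint G t.
Proof.
move=> HF HG It.
have := RintegralD measurableT (integrable_retr HF It) (integrable_retr HG It).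
rewrite /trint /integral_plane => <-.
by apply: eq_Rintegral => z _; rewrite retrD.
Qed.

Lemma trintZ (a : R) F t : rapid I F -> I t ->
  trint (fun w => a%:C *: F w) t = a * trint F t.
Proof.
move=> HF It.
have := RintegralZl a measurableT (integrable_retr HF It).
rewrite /trint /integral_plane => <-.
by apply: eq_Rintegral => z _; rewrite retrZ.
Qed.

Lemma trintN F t : rapid I F -> I t -> trint (fun w => - F w) t = - trint F t.
Proof.
move=> HF It; rewrite -[RHS]mulN1r -trintZ //.
by apply: eq_trint => z; rewrite retrZ mulN1r retrN.
Qed.

Lemma trintB F G t : rapid I F -> rapid I G -> I t ->
  trint (fun w => F w - G w) t = trint F t - trint G t.
Proof. by move=> HF HG It; rewrite trintD ?trintN //; exact: rapidN. Qed.

Lemma derive_retr_slice F t v z : rapid I F -> I t ->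
  'D_v (fun x => retr (F (t, x))) z = retr (dmx (0, v) F (t, z)).
Proof.
move=> H It; rewrite -(derive_slice (fun w => retr (F w))).
exact: (derive_val (is_derive := is_derive_retr (0, v) (decay_mdiff (w := (t, z)) (H 0%N) It))).
Qed.

(** Integration by parts, in the form in which it is used: divergences have
    zero integral. *)
Lemma trint_dx F t : rapid I F -> I t -> trint (dmx (st_x R) F) t = 0.
Proof.
move=> H It; have dH := rapid_dmx (st_x R) H.
have [B HB] := rapid_retr_bound1 4 dH It; have [B' HB'] := rapid_retr_bound1 4 H It.
have E z : 'D_(dir_x R) (fun x => retr (F (t, x))) z = retr (dmx (st_x R) F (t, z)).
  exact: derive_retr_slice.
have E' : 'D_(dir_x R) (fun x => retr (F (t, x))) = fun z => retr (dmx (st_x R) F (t, z)).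
  exact/funext.
rewrite /trint -E'; apply: (@integral_plane_derive_x _ _ (Num.max B B')).
- by move=> z; apply: diff_derivable; exact: differentiable_retr_slice.
- by rewrite E'; exact: continuous_retr_slice.
- by move=> z; rewrite E le_max HB.
- by move=> z; rewrite le_max HB' orbT.
Qed.

Lemma trint_dy F t : rapid I F -> I t -> trint (dmx (st_y R) F) t = 0.
Proof.
move=> H It; have dH := rapid_dmx (st_y R) H.
have [B HB] := rapid_retr_bound1 4 dH It; have [B' HB'] := rapid_retr_bound1 4 H It.
have E z : 'D_(dir_y R) (fun x => retr (F (t, x))) z = retr (dmx (st_y R) F (t, z)).
  exact: derive_retr_slice.
have E' : 'D_(dir_y R) (fun x => retr (F (t, x))) = fun z => retr (dmx (st_y R) F (t, z)).
  exact/funext.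
rewrite /trint -E'; apply: (@integral_plane_derive_y _ _ (Num.max B B')).
- by move=> z; apply: diff_derivable; exact: differentiable_retr_slice.
- by rewrite E'; exact: continuous_retr_slice.
- by move=> z; rewrite E le_max HB.
- by move=> z; rewrite le_max HB' orbT.
Qed.

Lemma is_derive_trint F t : rapid I F -> I t ->
  is_derive t (1 : R) (trint F) (trint (dmx (st_t R) F) t).
Proof.
move=> H It; have dH := rapid_dmx (st_t R) H.
have [e /= e0 eI] : exists2 e : R, 0 < e & [set` `[t - e, t + e]] `<=` I.
  have /nbhs_ballP[e /= e0 eI] := open_nbhs_nbhs (conj oI It).
  exists (e / 2); rewrite ?divr_gt0 // => x /=; rewrite in_itv /= => /andP[x1 x2].
  by apply: eI; rewrite /ball /= ltr_norml; apply/andP; split; lra.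
have [B HB] := rapid_retr_bound dH eI 4.
pose f (s : R) (z : plane) := retr (F (s, z)).
have dft s z : I s -> is_derive s (1 : R) (f ^~ z) (retr (dmx (st_t R) F (s, z))).
  move=> Is.
  have E (x : R) : (x, z) = x *: st_t R + (0, z) :> spacetime.
    apply/pair_equal_spec; split => /=; first by rewrite addr0 [RHS]mulr1.
    by rewrite -[(0, 0)]/(0 : plane) scaler0 add0r.
  have D := is_derive_retr (st_t R) (decay_mdiff (H 0%N) (w := (s, z)) Is).
  have -> : f ^~ z = fun x : R => (fun w => retr (F w)) (x *: st_t R + (0, z)).
    by apply/funext => x; rewrite -E.
  rewrite -(derive_val (is_derive := D)) E; apply: is_derive_line.
  by rewrite -E; case: D.
have oo x : `]t - e, t + e[%classic x -> I x /\ x \in `[t - e, t + e].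
  move=> /= xI; have xc : x \in `[t - e, t + e] by apply: subset_itv_oo_cc.
  by split => //; exact: eI.
have tt : `]t - e, t + e[%classic t.
  by rewrite /= in_itv /= ltrBlDr !ltrDl e0.
have B0 : 0 <= B.
  have := HB t (oo _ tt).2 0; apply: le_trans.
  by rewrite mulr_ge0 // exprn_ge0 // addr_ge0.
have C := @cvg_differentiation_under_integral R _ _ (mu \x mu)%E f setT measurableT t
  (t - e) (t + e) tt.
have {}C := C (fun x xI => integrable_retr H (oo x xI).1).
have {}C := C (fun x z xI _ => @ex_derive _ _ _ _ _ _ _ (dft x z (oo x xI).1)).
have {}C := C (fun z => B * cauchy_weight z).
have {}C := C (fun z => mulr_ge0 B0 (cauchy_weight_ge0 z)).
have {}C := C (integrableZl measurableT B (integrable_cauchy_weight R)).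
have d1E x z : I x -> partial1of2 f x z = retr (dmx (st_t R) F (x, z)).
  by move=> Ix; rewrite partial1of2E (derive_val (is_derive := dft x z Ix)).
have {}C := C _.
have {C} C : h^-1 *: (trint F (h + t) - trint F t) @[h --> 0^'] -->
    trint (dmx (st_t R) F) t.
  rewrite (_ : trint (dmx _ F) t = \int[(mu \x mu)%E]_y partial1of2 f t y).
    apply: C => x z xI _; have [Ix xc] := oo x xI.
    by rewrite d1E //; apply: weight4_le => //; exact: HB.
  by apply: eq_Rintegral => z _; rewrite d1E.
have C' : (fun h : R => h^-1 *: ((trint F \o shift t) (h *: 1) - trint F t)) =
   (fun h => h^-1 *: (trint F (h + t) - trint F t)).
  by apply/funext => h /=; rewrite [h *: 1]mulr1.
split; first by rewrite /derivable C'; apply/cvg_ex; eexists; exact: C.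
by rewrite /derive C'; exact: cvg_lim C.
Qed.

Lemma retr_adj (A : mat) : 0 <= retr (A *m A ^t*).
Proof.
rewrite retrE sumr_ge0 // => i _; rewrite mxE.
elim/big_rec: _ => // j x _ x0; rewrite ReD addr_ge0 // !mxE.
case: (A i j) => a b /=; rewrite mulrN opprK.
by rewrite addr_ge0 // -expr2 sqr_ge0.
Qed.

Lemma retr_adj_eq0 (A : mat) : retr (A *m A ^t*) = 0 -> A = 0.
Proof.
have E : retr (A *m A ^t*) =
    \sum_i \sum_j (complex.Re (A i j) ^+ 2 + complex.Im (A i j) ^+ 2).
  rewrite retrE; apply: eq_bigr => i _; rewrite mxE.
  elim/big_rec2: _ => // j x y _ <-; rewrite ReD !mxE; congr (_ + _).
  by case: (A i j) => a b /=; rewrite mulrN opprK -!expr2.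
move=> /eqP; rewrite E psumr_eq0; last first.
  by move=> i _; apply: sumr_ge0 => j _; rewrite addr_ge0 // sqr_ge0.
move=> /allP H; apply/matrixP => i j; rewrite mxE.
have := H i (mem_index_enum _); rewrite /= psumr_eq0; last first.
  by move=> k _; rewrite addr_ge0 // sqr_ge0.
move=> /allP /(_ j (mem_index_enum _)) /=.
rewrite paddr_eq0 ?sqr_ge0 // !sqrf_eq0 => /andP[/eqP a0 /eqP b0].
exact: complex_eq.
Qed.

(** This makes the trace form definite on rapidly decaying functions. *)
Lemma trint_adj_eq0 F t : rapid I F -> I t ->
  trint (fun w => F w *m (F w) ^t*) t = 0 -> forall z, F (t, z) = 0.
Proof.
move=> H It E z; apply: retr_adj_eq0.
have H' : rapid I (fun w => F w *m (F w) ^t*).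
  by apply: rapidMl => //; apply: rapid_bounded; exact: rapidJ.
apply: (integral_plane_eq0 (f := fun z => retr (F (t, z) *m (F (t, z)) ^t*))) => //.
- exact: (continuous_retr_slice H' It).
- exact: (integrable_retr H' It).
- by move=> x; exact: retr_adj.
Qed.
End TraceIntegral.

(** * Skew-Hermitian matrices, unitary matrices and the Cayley transform *)

Section Gauge.
Variables (R : realType) (n : nat).
Local Notation mat := 'M[R[i]]_n.
Local Notation plane := (R * R)%type.
Local Notation spacetime := (R * (R * R))%type.
Implicit Types (A B S : mat).

Lemma adjD A B : (A + B) ^t* = A ^t* + B ^t*.
Proof. by rewrite linearD /= map_mxD. Qed.

Lemma adjN A : (- A) ^t* = - A ^t*.
Proof. by rewrite linearN /= map_mxN. Qed.

Lemma adjB A B : (A - B) ^t* = A ^t* - B ^t*.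
Proof. by rewrite adjD adjN. Qed.

Lemma adjM A B : (A *m B) ^t* = B ^t* *m A ^t*.
Proof. by rewrite trmx_mul map_mxM. Qed.

Lemma adjZ (a : R) A : (a%:C *: A) ^t* = a%:C *: A ^t*.
Proof.
apply/matrixP => i j; rewrite !mxE rmorphM /=; congr (_ * _).
by apply: complex_eq; rewrite ?Re_conjC ?Im_conjC //= oppr0.
Qed.

Lemma adj1 : (1%:M : mat) ^t* = 1%:M.
Proof. by rewrite trmx1 map_mx1. Qed.

Lemma skew_comm A B : skewhermmx A -> skewhermmx B -> skewhermmx (commx A B).
Proof.
rewrite /skewhermmx /commx => hA hB.
by rewrite adjB !adjM hA hB !mulmxN !mulNmx !opprK opprB.
Qed.

Lemma skewD A B : skewhermmx A -> skewhermmx B -> skewhermmx (A + B).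
Proof. by rewrite /skewhermmx adjD opprD => -> ->. Qed.

Lemma skewN A : skewhermmx A -> skewhermmx (- A).
Proof. by rewrite /skewhermmx adjN => ->. Qed.

Lemma skewZ (a : R) A : skewhermmx A -> skewhermmx (a%:C *: A).
Proof. by rewrite /skewhermmx adjZ => ->; rewrite scalerN. Qed.

Lemma unitary_adjM A : A \is unitarymx -> A ^t* *m A = 1%:M.
Proof. by move=> uA; rewrite -invmx_unitary // mulVmx // unitarymx_unit. Qed.

Lemma unitary_Madj A : A \is unitarymx -> A *m A ^t* = 1%:M.
Proof. by move/unitarymxP. Qed.

(** If K spans the left kernel of 1 - S, then K = K S, so K K^* = K S K^* is
    both Hermitian and skew-Hermitian, hence zero. *)
Lemma skew_unit S : skewhermmx S -> 1%:M - S \in unitmx.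
Proof.
move=> hS; rewrite -row_free_unit -kermx_eq0; apply/eqP.
set K := kermx _; apply: retr_adj_eq0.
have KS : K = K *m S.
  apply/eqP; rewrite -subr_eq0 -{1}[K]mulmx1 -mulmxBr; exact/eqP/mulmx_ker.
have E : K *m K ^t* = - (K *m K ^t*).
  by rewrite {1}[in X in _ *m X]KS adjM hS mulNmx mulmxN mulmxA -KS.
have : retr (K *m K ^t*) = - retr (K *m K ^t*) by rewrite {1}E retrN.
lra.
Qed.

Lemma unitary_entry A i j : A \is unitarymx -> Normc.normc (A i j) <= 1.
Proof.
move=> /unitary_Madj/matrixP/(_ i i); rewrite !mxE eqxx /= => /(congr1 (@complex.Re R)) /=.
rewrite -[1]/(1 : R) => E.
have {E} : complex.Re (A i j) ^+ 2 + complex.Im (A i j) ^+ 2 <= 1.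
  rewrite -[leRHS]E (_ : complex.Re (\sum_(k < n) A i k * A ^t* k i) =
    \sum_k (complex.Re (A i k) ^+ 2 + complex.Im (A i k) ^+ 2)).
    rewrite (bigD1 j) //= lerDl sumr_ge0 // => k _.
    by rewrite addr_ge0 // sqr_ge0.
  elim/big_rec2: _ => // k x y _ <-; rewrite ReD !mxE; congr (_ + _).
  by case: (A i k) => a b /=; rewrite mulrN opprK -!expr2.
case: (A i j) => a b /= ab; rewrite -sqrtr1; exact: ler_wsqrtr.
Qed.

Lemma mulmx_comm_inv A B : A \in unitmx -> B \in unitmx -> A *m B = B *m A ->
  B *m invmx A *m (invmx B *m A) = 1%:M.
Proof.
move=> uA uB AB.
(* A^-1 commutes with B, so the product is A^-1 B B^-1 A. *)
have BA : B *m invmx A = invmx A *m B.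
  by apply: (can_inj (mulKmx uA)); rewrite mulmxA AB mulmxK // mulKVmx.
by rewrite BA mulmxA mulmxK // mulVmx.
Qed.

Definition cayley S : mat := (1%:M + S) *m invmx (1%:M - S).

Lemma cayleyE S : skewhermmx S -> cayley S = invmx (1%:M - S) + invmx (1%:M - S) - 1%:M.
Proof.
move=> hS; have uS := skew_unit hS.
rewrite /cayley (_ : 1%:M + S = 1%:M + 1%:M - (1%:M - S)).
  by rewrite mulmxBl mulmxDl mul1mx mulmxV.
by rewrite opprB addrA [RHS]addrAC addrK.
Qed.

(** For skew-Hermitian S the adjoints of 1 + S and of 1 - S are each other,
    and the two commute. *)
Lemma cayley_unitary S : skewhermmx S -> cayley S \is unitarymx.
Proof.
move=> hS; have uS := skew_unit hS; have uN := skew_unit (skewN hS).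
rewrite opprK in uN; apply/unitarymxP.
have aX : (1%:M - S) ^t* = 1%:M + S by rewrite adjB adj1 hS opprK.
have aB : (invmx (1%:M - S)) ^t* = invmx (1%:M + S).
  apply: (can_inj (mulmxK uN)); rewrite mulVmx //.
  by rewrite -aX -adjM mulmxV // adj1.
have XY : (1%:M - S) *m (1%:M + S) = (1%:M + S) *m (1%:M - S).
  rewrite [LHS]mulmxBl [RHS]mulmxBr mul1mx mulmx1; congr (_ - _).
  by rewrite mulmxDr mulmxDl mulmx1 mul1mx.
by rewrite /cayley adjM aB adjD hS adj1; exact: mulmx_comm_inv.
Qed.
End Gauge.

(** * Logarithmic derivatives of unitary functions *)

Section GaugePotential.
Variables (R : realType) (n : nat).
Local Notation mat := 'M[R[i]]_n.
Local Notation plane := (R * R)%type.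
Local Notation spacetime := (R * (R * R))%type.
Variables (I : set R) (oI : open I) (Q : spacetime -> mat).
Hypothesis dQ : rapid I (fun w => Q w - 1%:M).
Hypothesis uQ : forall w, I w.1 -> Q w \is unitarymx.
Implicit Types (u v w : spacetime).

(** The form q^-1 dq evaluated on v. Writing the adjoint for the inverse makes
    its smoothness evident. *)
Definition potential (Q' : spacetime -> mat) v w : mat := (Q' w) ^t* *m dmx v Q' w.
Local Notation L := (potential Q).

Lemma gauge_bounded : decay 0 I Q.
Proof.
apply: (@eq_decay _ _ _ _ (fun w => (Q w - 1%:M) + 1%:M)) => //.
  by move=> w _; rewrite subrK.
by apply: decayD => //; exact: decay_cst.
Qed.

Lemma gauge_mdiff w : I w.1 -> mdiff Q w.
Proof. exact: (decay_mdiff gauge_bounded). Qed.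

Lemma gauge_dmx_rapid v : rapid I (dmx v Q).
Proof.
apply: (@eq_rapid _ _ _ oI (dmx v (fun w => Q w - 1%:M))); last exact: rapid_dmx.
move=> w Iw; rewrite dmxB ?dmx_cst ?subr0 //; exact: gauge_mdiff.
Qed.

Lemma potential_rapid v : rapid I (L v).
Proof. by apply: rapidMr => //; [apply: decayJ => //; exact: gauge_bounded|exact: gauge_dmx_rapid]. Qed.

Lemma gauge_dmx v w : I w.1 -> dmx v Q w = Q w *m L v w.
Proof. by move=> Iw; rewrite mulmxA unitary_Madj ?mul1mx // uQ. Qed.

(** This is the derivative of Q^* Q = 1. *)
Lemma gauge_dmx_adj v w : I w.1 -> (dmx v Q w) ^t* = - (L v w *m (Q w) ^t*).
Proof.
move=> Iw.
have : dmx v (fun x => (Q x) ^t* *m Q x) w = 0.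
  rewrite -(dmx_cst v (1%:M : mat) w); apply: near_eq_dmx.
  by apply: filterS (near_slab oI Iw) => x Ix; rewrite unitary_adjM // uQ.
rewrite dmxM ?dmx_adj; try exact: gauge_mdiff; last first.
  by apply: mdiff_adj; exact: gauge_mdiff.
move=> /eqP; rewrite addr_eq0 => /eqP E.
by rewrite -[LHS]mulmx1 -(unitary_Madj (uQ Iw)) mulmxA E mulNmx.
Qed.

Lemma potential_skew v w : I w.1 -> skewhermmx (L v w).
Proof.
move=> Iw; rewrite /skewhermmx adjM trmxCK gauge_dmx_adj // mulNmx -mulmxA.
by rewrite unitary_adjM ?mulmx1 // uQ.
Qed.

Lemma dmx_potential u v w : I w.1 ->
  dmx u (L v) w = (Q w) ^t* *m dmx u (dmx v Q) w - L u w *m L v w.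
Proof.
move=> Iw; rewrite dmxM; last 2 first.
- by apply: mdiff_adj; exact: gauge_mdiff.
- exact: (decay_mdiff (gauge_dmx_rapid v 0%N)).
rewrite dmx_adj; last exact: gauge_mdiff.
by rewrite gauge_dmx_adj // mulNmx -mulmxA addrC.
Qed.

(** The Maurer-Cartan equation: the mixed second derivatives of Q cancel, and
    each first derivative of Q^* is - L Q^*. *)
Lemma potential_flat u v w : I w.1 ->
  dmx u (L v) w = dmx v (L u) w + commx (L v w) (L u w).
Proof.
move=> Iw; rewrite !dmx_potential // (decay_dmx_comm oI v u gauge_bounded Iw) /commx.
by rewrite addrA subrK.
Qed.

Lemma dmx_skew (F : spacetime -> mat) v w :
  (forall x, I x.1 -> skewhermmx (F x)) -> mdiff F w -> I w.1 -> skewhermmx (dmx v F w).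
Proof.
move=> sF dF Iw; rewrite /skewhermmx -dmx_adj // -dmxN //.
by apply: near_eq_dmx; apply: filterS (near_slab oI Iw) => x; exact: sF.
Qed.

Lemma invmx_gauge w : I w.1 -> invmx (Q w) = (Q w) ^t*.
Proof. by move=> Iw; rewrite invmx_unitary // uQ. Qed.

Definition rpotential v w : mat := dmx v Q w *m invmx (Q w).

Lemma rpotentialE v w : I w.1 -> rpotential v w = Q w *m L v w *m (Q w) ^t*.
Proof. by move=> Iw; rewrite /rpotential invmx_gauge // gauge_dmx. Qed.

(** The derivatives of the conjugating factors contribute the commutator of
    L_v with itself, which vanishes. *)
Lemma dmx_rpotential v w : I w.1 ->
  dmx v (rpotential v) w = Q w *m dmx v (L v) w *m (Q w) ^t*.
Proof.
move=> Iw.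
rewrite (@near_eq_dmx _ _ _ _ _ (fun x => Q x *m L v x *m (Q x) ^t*)); last first.
  by apply: filterS (near_slab oI Iw) => x; exact: rpotentialE.
have mQ := gauge_mdiff Iw; have mL := decay_mdiff (potential_rapid v 0%N) Iw.
rewrite dmxM; [|exact: mdiffM|exact: mdiff_adj].
rewrite dmxM // dmx_adj // gauge_dmx_adj // gauge_dmx //.
by rewrite mulmxDl mulmxN !mulmxA addrAC addrN add0r.
Qed.

End GaugePotential.

(** * Curves with prescribed velocity *)

Section CurveExistence.
Variables (R : realType) (n : nat).
Local Notation mat := 'M[R[i]]_n.
Local Notation plane := (R * R)%type.
Local Notation spacetime := (R * (R * R))%type.

(** Multiplication by the time is written as a product of matrices so that
    closure under products applies to it. *)
Definition timemx (w : spacetime) : mat := (w.1%:C)%:M.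

Lemma timemx_mdiff w : mdiff timemx w.
Proof.
move=> i j; have d1 : differentiable (fst : spacetime -> R) w.
  by apply: linear_differentiable => x; exact: cvg_fst.
split.
- rewrite (_ : (fun x => _) = (fun x : spacetime => (i == j)%:R *: x.1)).
    exact: differentiableZ.
  by apply/funext => x; rewrite /timemx mxE; case: eqP => _ /=;
    rewrite /GRing.scale /= ?mul1r ?mul0r.
- rewrite (_ : (fun x => _) = (fun=> 0)); first exact: differentiable_cst.
  by apply/funext => x; rewrite /timemx mxE; case: eqP.
Qed.

Lemma dmx_timemx v w : dmx v timemx w = (v.1%:C)%:M.
Proof.
have d1 : differentiable (fst : spacetime -> R) w.
  by apply: linear_differentiable => x; exact: cvg_fst.
have Dv : 'D_v (fst : spacetime -> R) w = v.1.
  by rewrite deriveE // diff_lin // => x; exact: cvg_fst.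
apply/matrixP => i j; rewrite dmxE mxE; apply: complex_eq => /=.
- rewrite (_ : (fun x => _) = (fun x : spacetime => (i == j)%:R *: x.1)).
    rewrite deriveZ; last exact: diff_derivable.
    by rewrite Dv; case: eqP => _ /=; rewrite /GRing.scale /= ?mul1r ?mul0r.
  by apply/funext => x; rewrite /timemx mxE; case: eqP => _ /=;
    rewrite /GRing.scale /= ?mul1r ?mul0r.
- rewrite (_ : (fun x => _) = (fun=> 0)); last first.
    by apply/funext => x; rewrite /timemx mxE; case: eqP.
  by rewrite derive_cst; case: eqP.
Qed.

Lemma timemx_bounded (I : set R) : open I -> decay 0 I timemx.
Proof.
move=> oI; apply/decayP => m.
have C0 : decay0 0 I timemx.
  split=> [w _|a b _]; first exact: timemx_mdiff.
  exists (`|a| + `|b|) => t; rewrite in_itv /= => /andP[ta tb] z i j.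
  rewrite expr0 mul1r /timemx mxE; case: eqP => _ /=.
    rewrite expr0n /= addr0 sqrtr_sqr ler_norml; apply/andP; split.
      by have := ler_norm (- a); rewrite normrN; have := normr_ge0 b; lra.
    by have := ler_norm b; have := normr_ge0 a; lra.
  by rewrite expr0n /= addr0 sqrtr0 addr_ge0.
case: m => [|m]; first by rewrite decayn0.
apply/decaynS; split=> // v.
rewrite (_ : dmx v timemx = fun=> (v.1%:C)%:M).
  by have /decayP := @decay_cst R n I (v.1%:C)%:M; apply.
by apply/funext => w; exact: dmx_timemx.
Qed.

Lemma dmx0 (V : normedModType R) (F : V -> mat) z : dmx 0 F z = 0.
Proof.
by apply/matrixP => i j; rewrite dmxE mxE /cder !derive0.
Qed.

Lemma dmx_t_snd (f : plane -> mat) w : dmx (st_t R) (fun x => f x.2) w = 0.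
Proof. by rewrite dmx_snd dmx0. Qed.

Lemma rapid_mdiff_snd (f : plane -> mat) w : rapid setT (fun w => f w.2) ->
  mdiff (fun w : spacetime => f w.2) w.
Proof. by move=> H; exact: (decay_mdiff (H 0%N)). Qed.

Lemma scaled_curve (f : plane -> mat) : rapidly_decaying f ->
  rapid setT (fun w => timemx w *m f w.2).
Proof.
move=> /rapidly_decayingP H; apply: rapidMr => //; first exact: openT.
by apply: timemx_bounded; exact: openT.
Qed.

Lemma timemxE (t : R) (z : plane) (A : mat) : timemx (t, z) *m A = t%:C *: A.
Proof. by rewrite /timemx mul_scalar_mx. Qed.

Section Cayley.
Variable eta : plane -> mat.
Hypothesis Heta : algebra_map eta.

Definition half_eta (w : spacetime) : mat := (2^-1)%:C *: (timemx w *m eta w.2).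

Lemma half_eta_skew w : skewhermmx (half_eta w).
Proof.
case: w => t z; apply: skewZ; rewrite timemxE; apply: skewZ.
by case: Heta.
Qed.

Lemma half_eta_rapid : rapid setT half_eta.
Proof.
by apply: rapidZ; [exact: openT|apply: scaled_curve; case: Heta].
Qed.

Definition resolvent (w : spacetime) : mat := invmx (1%:M - half_eta w).

(** Since (1 - S)^-1 = (cayley S + 1) / 2 and the entries of a unitary matrix
    have modulus at most 1, so do those of the resolvent; decay_inv then takes
    care of the derivatives. *)
Lemma resolvent_bounded : decay 0 setT resolvent.
Proof.
apply: decay_inv; first exact: openT.
- apply: decayD; [exact: openT|exact: decay_cst|].
  by apply: decayN; [exact: openT|exact: rapid_bounded half_eta_rapid].
- by move=> w _; apply: skew_unit; exact: half_eta_skew.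
- move=> a b _; exists 1 => t _ z i j; rewrite expr0 mul1r.
  have sk := half_eta_skew (t, z).
  have E : invmx (1%:M - half_eta (t, z)) = (2^-1)%:C *: (cayley (half_eta (t, z)) + 1%:M).
    rewrite cayleyE // subrK scalerDr -scalerDl (_ : _ + _ = 1) ?scale1r //.
    by apply: complex_eq => /=; rewrite ?addr0 //; lra.
  rewrite E mxE [X in _ * X]mxE [X in _ + X]mxE Normc.normcM.
  have c1 := unitary_entry i j (cayley_unitary sk).
  have c2 : Normc.normc ((i == j)%:R : R[i]) <= 1.
    case: eqP => _; first by rewrite Normc.normc1.
    by rewrite Normc.normc0.
  have c3 := le_normcD (cayley (half_eta (t, z)) i j) (i == j)%:R.
  have -> : Normc.normc ((2^-1 : R)%:C) = 2^-1.
    by rewrite /= expr0n /= addr0 sqrtr_sqr ger0_norm // invr_ge0.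
  lra.
Qed.

Definition cayley_curve (w : spacetime) : mat := cayley (half_eta w).

Lemma double_sub (A B : mat) : A - B + (A - B) = A + A - B - B.
Proof. by rewrite !addrA; congr (_ - _); rewrite addrAC. Qed.

Lemma cayley_curve_rapid : rapid setT (fun w => cayley_curve w - 1%:M).
Proof.
(* The Cayley transform minus 1 is 2 S (1 - S)^-1, which has the decay of S. *)
apply: (@eq_rapid _ _ _ openT (fun w => (half_eta w *m resolvent w) + (half_eta w *m resolvent w))).
  move=> w _; have uS := skew_unit (half_eta_skew w).
  rewrite /cayley_curve cayleyE; last exact: half_eta_skew.
  have -> : half_eta w *m resolvent w = invmx (1%:M - half_eta w) - 1%:M.
    rewrite -[X in X *m _](subKr 1%:M) mulmxBl mul1mx mulmxV //.
  exact: double_sub.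
by apply: rapidD; try exact: openT; apply: rapidMl; try exact: openT;
  (exact: half_eta_rapid || exact: resolvent_bounded).
Qed.

Lemma half_eta0 z : half_eta (0, z) = 0.
Proof. by rewrite /half_eta timemxE scale0r scaler0. Qed.

Lemma cayley_curve0 z : cayley_curve (0, z) = 1%:M.
Proof. by rewrite /cayley_curve half_eta0 /cayley addr0 subr0 mul1mx invmx1. Qed.

Lemma dmx_t_scaled (f : plane -> mat) t z : rapidly_decaying f ->
  dmx (st_t R) (fun w => timemx w *m f w.2) (t, z) = f z.
Proof.
move=> /rapidly_decayingP H.
rewrite dmxM; [|exact: timemx_mdiff|exact: rapid_mdiff_snd].
by rewrite dmx_timemx dmx_t_snd mulmx0 addr0 mul1mx.
Qed.

Lemma dmx_t_cayley0 z : dmx (st_t R) cayley_curve (0, z) = eta z.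
Proof.
have md w : mdiff half_eta w by apply: (decay_mdiff (half_eta_rapid 0%N)).
have mr w : mdiff resolvent w by apply: (decay_mdiff resolvent_bounded).
have rdeta : rapidly_decaying eta by case: Heta.
have E : cayley_curve = fun w => resolvent w + resolvent w - 1%:M.
  by apply/funext => w; rewrite /cayley_curve cayleyE //; exact: half_eta_skew.
rewrite E dmxB; [|exact: mdiffD|exact: mdiff_cst].
rewrite dmxD // dmx_cst subr0.
have -> : dmx (st_t R) resolvent (0, z) = dmx (st_t R) half_eta (0, z).
  rewrite dmx_inv; last 2 first.
  - apply: (filterS _ (near_slab (w := (0, z)) openT Logic.I)) => w _.
    by apply: skew_unit; exact: half_eta_skew.
  - by apply: mdiffB => //; exact: mdiff_cst.
  by rewrite dmxB // dmx_cst half_eta0 subr0 invmx1 mul1mx mulmx1 sub0r opprK.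
rewrite dmxZ; last by apply: (decay_mdiff (scaled_curve rdeta 0%N)).
rewrite dmx_t_scaled // -scalerDl (_ : _ + _ = 1) ?scale1r //.
by apply: complex_eq => /=; rewrite ?addr0 //; lra.
Qed.
End Cayley.

(** The Cayley transform replaces the exponential: it is unitary at all times
    and has the same velocity eta at time 0, but is rational in t eta. *)
Lemma curve_at_exists (m X : fields R n) : phase m -> tangent X ->
  exists (I : set R) c, curve_at m X I c.
Proof.
case: m X => p q [xi eta] [/= [rp sp] [rq uq]] [/= hxi heta].
have [rxi sxi] := hxi.
have rdp := (rapidly_decayingP _).1 rp.
have rdq := (rapidly_decayingP _).1 rq.
have rdxi := scaled_curve rxi.
pose P w := p w.2 + timemx w *m xi w.2.
pose Q w := q w.2 *m cayley_curve eta w.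
have rapidP : rapid setT P by apply: rapidD => //; exact: openT.
have bq : decay 0 setT (fun w : spacetime => q w.2) by apply: gauge_bounded => //; exact: openT.
have bc : decay 0 setT (cayley_curve eta).
  by apply: gauge_bounded; [exact: openT|exact: cayley_curve_rapid].
exists setT, (fun t => (fun z => P (t, z), fun z => Q (t, z))).
split => //; first exact: openT.
- split; split=> /=.
  + apply/rapidly_decaying_curveP.
    by rewrite (_ : joint _ = P) //; apply/funext => -[].
  + move=> t _ z; rewrite /P /= timemxE; apply: skewD; first exact: sp.
    by apply: skewZ.
  + apply/rapidly_decaying_curveP.
    (* q c - 1 = (q - 1) c + (c - 1) *)
    apply: (@eq_rapid _ _ _ openT (fun w => (q w.2 - 1%:M) *m cayley_curve eta w
        + (cayley_curve eta w - 1%:M))).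
      by move=> -[t z] _; rewrite /joint /Q /= mulmxBl mul1mx addrA subrK.
    apply: rapidD; first exact: openT.
      by apply: rapidMl => //; exact: openT.
    exact: cayley_curve_rapid.
  + move=> t _ z; rewrite /Q /=; apply/unitarymxP; rewrite adjM mulmxA.
    rewrite -(mulmxA (q z)) unitary_Madj ?mulmx1 ?unitary_Madj //.
    by apply: cayley_unitary; exact: half_eta_skew.
- split.
    by congr pair; apply/funext => z; rewrite /P /Q /= ?timemxE ?scale0r ?addr0 //
      cayley_curve0 mulmx1.
  rewrite /velocity /logder_t /=; congr pair; apply/funext => z.
    rewrite (_ : joint _ = P); last by apply/funext => -[].
    rewrite dmxD; [|exact: rapid_mdiff_snd|exact: (decay_mdiff (rdxi 0%N))].
    by rewrite dmx_t_snd add0r dmx_t_scaled.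
  rewrite (_ : joint _ = Q); last by apply/funext => -[].
  rewrite dmxM; [|exact: (decay_mdiff bq)|exact: (decay_mdiff bc)].
  rewrite dmx_t_snd mul0mx add0r dmx_t_cayley0 // /Q cayley_curve0 mulmx1.
  by rewrite mulKmx // unitarymx_unit.
Qed.
End CurveExistence.

(** * Trace identities *)

(** Stated for a trace on an abstract ring: the proofs expand into words in
    noncommuting letters, rotate equal cyclic words into the same form, and
    compare coefficients. *)
Section TraceIdentities.
Variables (R : comPzRingType) (K : pzRingType) (tr : K -> R).
Hypothesis trD : forall a b, tr (a + b) = tr a + tr b.
Hypothesis trN : forall a, tr (- a) = - tr a.
Hypothesis trC : forall a b, tr (a * b) = tr (b * a).
Local Notation "[[ a , b ]]" := (a * b - b * a) (at level 0, format "[[ a ,  b ]]").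

Local Lemma tr_rot3 a b c : tr (a * b * c) = tr (b * c * a).
Proof. by rewrite -mulrA trC. Qed.

Local Lemma tr_rot4 a b c d : tr (a * b * c * d) = tr (b * c * d * a).
Proof. by rewrite -!mulrA trC !mulrA. Qed.

Local Lemma tr0 : tr 0 = 0.
Proof. by apply: (addrI (tr 0)); rewrite -trD !addr0. Qed.

Ltac expand_traces :=
  rewrite ?(trD, trN) ?mul0r ?tr0 !(mulrDl, mulrDr, mulrN, mulNr) ?mulrA;
  rewrite !(trD, trN).

Ltac abstract_traces :=
  repeat match goal with |- context [tr ?A] =>
    let r := fresh "r" in set r := (tr A); clearbody r end.

Lemma trace_lin (s : K -> K) (k : R) x1 x2 y1 y2 z1 z2 u :
  (forall a b, s a * b = s (a * b)) -> (forall a b, a * s b = s (a * b)) ->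
  (forall a, tr (s a) = k * tr a) ->
  tr ((s x1 + y1) * z2 - z1 * (s x2 + y2) + u * [[s x2 + y2, z2]]) =
  k * tr (x1 * z2 - z1 * x2 + u * [[x2, z2]]) +
  tr (y1 * z2 - z1 * y2 + u * [[y2, z2]]).
Proof.
move=> sl sr st; expand_traces; rewrite !(sl, sr) !st; abstract_traces; ring.
Qed.

(** The terms in x1, y1, z1 cancel in pairs, those in p by the Jacobi
    identity, and those in u by the Jacobi identity and the invariance of the
    trace. What remains is, up to cyclic rotation, the derivative of x [y, z].
    *)
Lemma trace_closed x1 y1 z1 x y z dx dy dz u p :
  tr ((dx + [[u, x]] - x1) * [[y, z]]) - tr ((dy + [[u, y]] - y1) * [[x, z]])
  + tr ((dz + [[u, z]] - z1) * [[x, y]])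
  - tr (0 * z - z1 * [[x, y]] + (u - p) * [[[[x, y]], z]])
  + tr (0 * y - y1 * [[x, z]] + (u - p) * [[[[x, z]], y]])
  - tr (0 * x - x1 * [[y, z]] + (u - p) * [[[[y, z]], x]])
  = tr (dx * [[y, z]] + x * ([[dy, z]] + [[y, dz]])).
Proof.
expand_traces; rewrite !(tr_rot4 x u) !(tr_rot4 y u) !(tr_rot4 z u).
rewrite !(tr_rot3 x dy) !(tr_rot3 x dz) -!(tr_rot3 dy x) -!(tr_rot3 dz x).
abstract_traces; ring.
Qed.

(** This is the identity that determines the Hamiltonian vector field: pairing
    with (h + [p, u], p) under the 2-form must give the differential of H. *)
Lemma trace_hamilton p u h x1 x2 :
  tr (x1 * p - (h + [[p, u]]) * x2 + (u - p) * [[x2, p]]) = tr (p * x1 - h * x2).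
Proof.
expand_traces; rewrite -!(tr_rot3 p u x2) -!(tr_rot3 p p x2).
rewrite (trC x1 p); abstract_traces; ring.
Qed.

(** Flatness introduces [l, a] into the derivative of l, and this term is
    orthogonal to l. *)
Lemma trace_comm_self l a da : tr (l * (da + [[l, a]])) = tr (l * da).
Proof. expand_traces; rewrite -(tr_rot3 l l a); abstract_traces; ring. Qed.

Lemma trace_energy p p' a b h k q dx dy :
  tr (p' * p + p * p') + (2 * tr (a * dx) + 2 * tr (b * dy)) =
  2 * tr (p * p' - (h + k) * q + (h * q + a * dx + (k * q + b * dy))).
Proof. expand_traces; rewrite (trC p'); abstract_traces; ring. Qed.

End TraceIdentities.

(** * The 2-form along curves *)

Section Forms.
Variables (R : realType) (n : nat).
Local Notation mat := 'M[R[i]]_n.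
Local Notation plane := (R * R)%type.
Local Notation spacetime := (R * (R * R))%type.
Local Notation fields := (fields R n).
Local Notation potential := (@potential R n).
Implicit Types (I : set R) (c xs ys : R -> fields) (m X Y Z : fields) (t : R).

Definition mom c (w : spacetime) : mat := (c w.1).1 w.2.
Definition pos c (w : spacetime) : mat := (c w.1).2 w.2.

Lemma mom_rapid I c : algebra_curve I (fun t => (c t).1) -> rapid I (mom c).
Proof. by case=> /rapidly_decaying_curveP. Qed.

Lemma pos_rapid I c : algebra_curve I (fun t => (c t).2) -> rapid I (pos c).
Proof. by case=> /rapidly_decaying_curveP. Qed.

Lemma phase_mom I c : phase_curve I c -> rapid I (mom c).
Proof. by case=> /mom_rapid. Qed.

Lemma phase_pos I c : phase_curve I c -> rapid I (fun w => pos c w - 1%:M).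
Proof. by case=> _ [] /rapidly_decaying_curveP. Qed.

Lemma phase_unitary I c : phase_curve I c ->
  forall w, I w.1 -> pos c w \is unitarymx.
Proof. by case=> _ [] _ H w Iw; exact: H. Qed.

Lemma tangent_mom I xs : tangent_curve I xs -> rapid I (mom xs).
Proof. by case=> /mom_rapid. Qed.

Lemma tangent_pos I xs : tangent_curve I xs -> rapid I (pos xs).
Proof. by case=> _ /pos_rapid. Qed.

Lemma phase_slice I c t : phase_curve I c -> I t -> phase (c t).
Proof.
move=> pc It; have [[_ h1] [_ h2]] := pc.
split; split.
- exact: (rapid_slice It (phase_mom pc)).
- exact: h1.
- exact: (rapid_slice It (phase_pos pc)).
- exact: h2.
Qed.

Lemma tangent_slice I xs t : tangent_curve I xs -> I t -> tangent (xs t).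
Proof.
move=> pc It; have [[_ h1] [_ h2]] := pc.
split; split.
- exact: (rapid_slice It (tangent_mom pc)).
- exact: h1.
- exact: (rapid_slice It (tangent_pos pc)).
- exact: h2.
Qed.

Lemma rapid_subset I (F : spacetime -> mat) : rapid setT F -> rapid I F.
Proof. by move=> H k; exact: (decay_sub (@subsetT _ I) (H k)). Qed.

Lemma algebra_map_cst I (xi : plane -> mat) : algebra_map xi ->
  algebra_curve I (fun=> xi).
Proof.
move=> [/rapidly_decayingP r s]; split; last by move=> t _ z; exact: s.
apply/rapidly_decaying_curveP; exact: rapid_subset.
Qed.

Lemma phase_cst I m : phase m -> phase_curve I (fun=> m).
Proof.
move=> [h1 [/rapidly_decayingP r u]]; split; first exact: algebra_map_cst.
split; last by move=> t _ z; exact: u.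
apply/rapidly_decaying_curveP; exact: rapid_subset.
Qed.

Lemma tangent_cst I X : tangent X -> tangent_curve I (fun=> X).
Proof. by case=> h1 h2; split; exact: algebra_map_cst. Qed.

Lemma algebra_map_lin (a : R) (xi eta : plane -> mat) : algebra_map xi ->
  algebra_map eta -> algebra_map (a%:C *: xi + eta).
Proof.
move=> [/rapidly_decayingP r s] [/rapidly_decayingP r' s']; split.
  apply/rapidly_decayingP; apply: (rapidD openT) => //; exact: (rapidZ openT).
by move=> z; apply: skewD; [apply: skewZ; exact: s|exact: s'].
Qed.

Lemma tangent_lin (a : R) X Y : tangent X -> tangent Y -> tangent (a%:C *: X + Y).
Proof. by move=> [? ?] [? ?]; split; exact: algebra_map_lin. Qed.

Lemma tangent0 X : tangent X -> tangent (0 : fields).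
Proof.
move=> hX; have := tangent_lin (-1) hX hX.
rewrite (_ : _ + X = 0) // (_ : (-1)%:C = -1); last by apply: complex_eq; rewrite ?ReN ?ImN //= oppr0.
by rewrite scaleN1r addNr.
Qed.

Lemma algebra_map_comm (xi eta : plane -> mat) : algebra_map xi ->
  algebra_map eta -> algebra_map (fun z => commx (xi z) (eta z)).
Proof.
move=> [/rapidly_decayingP r s] [/rapidly_decayingP r' s']; split.
  by apply/rapidly_decayingP; exact: (rapid_comm openT r r').
by move=> z; exact: skew_comm.
Qed.

Lemma tangent_bracket X Y : tangent X -> tangent Y -> tangent (bracket X Y).
Proof.
move=> hX hY; split; first by case: (tangent0 hX).
by apply: algebra_map_comm; [case: hX|case: hY].
Qed.

Lemma is_dirderiv_unique (f : fields -> R) m X l l' :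
  is_dirderiv f m X l -> is_dirderiv f m X l' -> l = l'.
Proof.
move=> [[I [c mc]] H] [_ H'].
by rewrite -(derive_val (is_derive := H _ _ mc)) (derive_val (is_derive := H' _ _ mc)).
Qed.

Lemma dirderivE (f : fields -> R) m X l : is_dirderiv f m X l -> dirderiv f m X = l.
Proof.
move=> H; apply: (@is_dirderiv_unique f m X) => //.
rewrite /dirderiv; exact: (xgetPex 0 (ex_intro _ l H)).
Qed.

(** That some curve has velocity X at m, as the definition requires, always
    holds. *)
Lemma is_dirderiv_intro (f : fields -> R) m X l : phase m -> tangent X ->
  (forall I c, curve_at m X I c -> is_derive (0 : R) (1 : R) (f \o c) l) ->
  is_dirderiv f m X l.
Proof. by move=> pm tX H; split; first exact: curve_at_exists. Qed.

Section CurveAt.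
Variables (m X : fields) (I : set R) (c : R -> fields).
Hypothesis mc : curve_at m X I c.

Lemma curve_at_open : open I. Proof. by case: mc. Qed.
Lemma curve_at0 : I 0. Proof. by case: mc. Qed.
Lemma curve_at_phase : phase_curve I c. Proof. by case: mc. Qed.

Lemma curve_at_mom z : mom c (0, z) = m.1 z.
Proof. by case: mc => _ _ _ _ [<- _]. Qed.

Lemma curve_at_pos z : pos c (0, z) = m.2 z.
Proof. by case: mc => _ _ _ _ [<- _]. Qed.

Lemma curve_at_dmom z : dmx (st_t R) (mom c) (0, z) = X.1 z.
Proof. by case: mc => _ _ _ _ [_ <-]. Qed.

Lemma curve_at_potential z : potential (pos c) (st_t R) (0, z) = X.2 z.
Proof.
have u := phase_unitary curve_at_phase (w := (0, z)) curve_at0.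
by case: mc => _ _ _ _ [_ <-]; rewrite /velocity /= /logder_t invmx_unitary.
Qed.
End CurveAt.

(** Theta does not involve q explicitly, so only p varies along the curve. *)
Lemma is_dirderiv_Theta m X Y : phase m -> tangent X -> tangent Y ->
  is_dirderiv ((@Theta R n)^~ Y) m X (pairing X.1 Y.2).
Proof.
move=> pm tX tY; apply: is_dirderiv_intro => // I c mc.
have oI := curve_at_open mc; have I0 := curve_at0 mc; have pc := curve_at_phase mc.
have rY := tangent_pos (tangent_cst I tY).
have rM : rapid I (fun w => mom c w *m pos (fun=> Y) w).
  by apply: rapidMl => //; exact: phase_mom.
have := is_derive_trint oI rM I0.
rewrite (_ : trint (dmx _ _) 0 = pairing X.1 Y.2) //.
congr integral_plane; apply/funext => z; congr retr.
rewrite dmxM; last 2 first.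
- exact: (decay_mdiff (phase_mom pc 0%N)).
- exact: (decay_mdiff (rY 0%N)).
by rewrite dmx_t_snd mulmx0 addr0 (curve_at_dmom mc).
Qed.

Lemma ext_deriv1_Theta m X Y : phase m -> tangent X -> tangent Y ->
  ext_deriv1 (@Theta R n) m X Y =
  pairing X.1 Y.2 - pairing Y.1 X.2 - pairing m.1 (fun z => commx (X.2 z) (Y.2 z)).
Proof.
move=> pm tX tY; rewrite /ext_deriv1.
by rewrite (dirderivE (is_dirderiv_Theta pm tX tY)) (dirderivE (is_dirderiv_Theta pm tY tX)).
Qed.

Variable theta : R.

Definition vpotential (Q : spacetime -> mat) (w : spacetime) : mat :=
  (cos theta)%:C *: potential Q (st_x R) w + (sin theta)%:C *: potential Q (st_y R) w.

Lemma vpotential_slice I c t z : phase_curve I c -> I t ->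
  invmx ((c t).2 z) *m ((cos theta)%:C *: dmx (dir_x R) (c t).2 z +
                        (sin theta)%:C *: dmx (dir_y R) (c t).2 z)
  = vpotential (pos c) (t, z).
Proof.
move=> pc It; have u := phase_unitary pc (w := (t, z)) It.
rewrite /vpotential /potential.
rewrite (invmx_unitary u) mulmxDr -!scalemxAr.
by rewrite (dmx_slice (pos c)) (dmx_slice (pos c)).
Qed.

Lemma vpotential_rapid I c : open I -> phase_curve I c -> rapid I (vpotential (pos c)).
Proof.
move=> oI pc; apply: (rapidD oI); apply: (rapidZ oI); apply: (potential_rapid oI);
  exact: phase_pos.
Qed.

(** The first tangent vector has components X and Y, the second Z and W. *)
Definition ward_density c (X Y Z W : spacetime -> mat) (w : spacetime) : mat :=
  X w *m W w - Z w *m Y w +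
  (vpotential (pos c) w - mom c w) *m commx (Y w) (W w).

Lemma ward_density_rapid I c (X Y Z W : spacetime -> mat) : open I -> phase_curve I c ->
  rapid I X -> rapid I Y -> rapid I Z -> rapid I W -> rapid I (ward_density c X Y Z W).
Proof.
move=> oI pc rX rY rZ rW; apply: (rapidD oI).
  by apply: (rapidB oI); apply: (rapidMl oI) => //; exact: rapid_bounded.
apply: (rapidMl oI); last by apply: rapid_bounded; exact: (rapid_comm oI).
by apply: (rapidB oI); [exact: vpotential_rapid|exact: phase_mom].
Qed.

Lemma ward_formE I c (X Y : R -> fields) t : open I -> phase_curve I c -> tangent_curve I X ->
  tangent_curve I Y -> I t ->
  ward_form theta (c t) (X t) (Y t) =
  trint (ward_density c (mom X) (pos X) (mom Y) (pos Y)) t.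
Proof.
move=> oI pc tX tY It.
rewrite /ward_form ext_deriv1_Theta; [|exact: phase_slice pc It|
  exact: tangent_slice tX It|exact: tangent_slice tY It].
have rX1 := tangent_mom tX; have rX2 := tangent_pos tX.
have rY1 := tangent_mom tY; have rY2 := tangent_pos tY.
have rP := phase_mom pc; have rU := vpotential_rapid oI pc.
pose C w := commx (pos X w) (pos Y w).
have rC : rapid I C by exact: (rapid_comm oI).
have -> : tau theta (c t) (X t) (Y t) = trint (fun w => vpotential (pos c) w *m C w) t.
  congr integral_plane; apply/funext => z; congr (retr (_ *m _)).
  exact: (vpotential_slice z pc It).
rewrite -[pairing (X t).1 _]/(trint (fun w => mom X w *m pos Y w) t).
rewrite -[pairing (Y t).1 _]/(trint (fun w => mom Y w *m pos X w) t).
rewrite -[pairing (c t).1 _]/(trint (fun w => mom c w *m C w) t).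
have r1 := rapidMl oI rX1 (rapid_bounded rY2); have r2 := rapidMl oI rY1 (rapid_bounded rX2).
have r3 := rapidMl oI rP (rapid_bounded rC); have r4 := rapidMl oI rU (rapid_bounded rC).
rewrite -(trintB oI r1 r2 It) -(trintB oI (rapidB oI r1 r2) r3 It).
rewrite -(trintD (rapidB oI (rapidB oI r1 r2) r3) r4 It).
apply: eq_trint => z; congr retr; rewrite /ward_density mulmxBl.
by rewrite -addrA (addrC (- _)).
Qed.

Lemma ward_form_static m X Y : phase m -> tangent X -> tangent Y ->
  ward_form theta m X Y =
  trint (ward_density (fun=> m) (mom (fun=> X)) (pos (fun=> X))
                      (mom (fun=> Y)) (pos (fun=> Y))) 0.
Proof.
move=> pm tX tY.
exact: (ward_formE (t := 0) openT (phase_cst _ pm) (tangent_cst _ tX) (tangent_cst _ tY)).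
Qed.

(** Each time derivative of a rapidly decaying function is again rapidly
    decaying, so differentiation under the integral sign can be repeated. *)
Lemma trint_smooth I (F : spacetime -> mat) (g : R -> R) : open I -> rapid I F ->
  (forall t, I t -> g t = trint F t) ->
  forall k t, I t -> derive1n k g t = trint (iter k (dmx (st_t R)) F) t /\
    derivable (derive1n k g) t 1.
Proof.
move=> oI rF gF.
have rk k : rapid I (iter k (dmx (st_t R)) F).
  by elim: k => //= k; exact: rapid_dmx.
have main k t (h : R -> R) : I t -> (forall s, I s -> h s = trint (iter k (dmx (st_t R)) F) s) ->
    is_derive t (1 : R) h (trint (iter k.+1 (dmx (st_t R)) F) t).
  move=> It hE; apply: near_eq_is_derive (is_derive_trint oI (rk k) It).
  by apply: filterS (open_nbhs_nbhs (conj oI It)) => s Is; rewrite hE.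
elim=> [|k IH] t It; first by split; [exact: gF|case: (main 0%N t g It gF)].
have E s : I s -> derive1n k g s = trint (iter k (dmx (st_t R)) F) s.
  by move=> /IH[].
have E' s : I s -> derive1n k.+1 g s = trint (iter k.+1 (dmx (st_t R)) F) s.
  move=> Is; rewrite derive1nS derive1E.
  exact: (derive_val (is_derive := main k s _ Is E)).
by split; [exact: E'|case: (main k.+1 t _ It E')].
Qed.

Lemma ward_is_two_form : is_two_form (@ward_form R n theta).
Proof.
split.
- move=> m pm a X Y Z tX tY tZ.
  have tXY := tangent_lin a tX tY.
  rewrite !ward_form_static //.
  have pc := phase_cst setT pm.
  have [rX1 rX2] := (tangent_mom (tangent_cst setT tX), tangent_pos (tangent_cst setT tX)).
  have [rY1 rY2] := (tangent_mom (tangent_cst setT tY), tangent_pos (tangent_cst setT tY)).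
  have [rZ1 rZ2] := (tangent_mom (tangent_cst setT tZ), tangent_pos (tangent_cst setT tZ)).
  have d1 := ward_density_rapid openT pc rX1 rX2 rZ1 rZ2.
  have d2 := ward_density_rapid openT pc rY1 rY2 rZ1 rZ2.
  rewrite -(trintZ a d1 Logic.I) -(trintD (rapidZ openT _ d1) d2 Logic.I).
  apply: eq_trint => z; rewrite retrD retrZ.
  apply: (@trace_lin R mat (@retr R n) (@retrD R n) (@retrN R n) (fun A => a%:C *: A)).
  + by move=> A B; exact: (esym (scalemxAl _ _ _)).
  + by move=> A B; exact: (esym (scalemxAr _ _ _)).
  + exact: retrZ.
- move=> m pm X Y tX tY; rewrite !ward_form_static //.
  have pc := phase_cst setT pm.
  have [rX1 rX2] := (tangent_mom (tangent_cst setT tX), tangent_pos (tangent_cst setT tX)).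
  have [rY1 rY2] := (tangent_mom (tangent_cst setT tY), tangent_pos (tangent_cst setT tY)).
  have d1 := ward_density_rapid openT pc rY1 rY2 rX1 rX2.
  rewrite -(trintN d1 Logic.I); apply: eq_trint => z; congr retr.
  rewrite /ward_density opprD opprB; congr (_ + _).
  by rewrite -mulmxN /commx opprB.
- move=> I c X Y oI _ pc tX tY k t It.
  have d := ward_density_rapid oI pc (tangent_mom tX) (tangent_pos tX)
    (tangent_mom tY) (tangent_pos tY).
  apply: (trint_smooth oI d _ k It).2.
  by move=> s Is; exact: (ward_formE oI pc tX tY Is).
Qed.

End Forms.

(** * Closedness and nondegeneracy *)

Section Symplectic.
Variables (R : realType) (n : nat) (theta : R).
Local Notation mat := 'M[R[i]]_n.
Local Notation plane := (R * R)%type.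
Local Notation spacetime := (R * (R * R))%type.
Local Notation fields := (fields R n).
Local Notation potential := (@potential R n).
Local Notation vpotential := (vpotential theta).
Implicit Types (I : set R) (m X Y Z : fields) (t : R).

Definition vdmx (F : spacetime -> mat) (w : spacetime) : mat :=
  (cos theta)%:C *: dmx (st_x R) F w + (sin theta)%:C *: dmx (st_y R) F w.

Lemma scale_leibniz (a b : R[i]) (A B C D E F : mat) :
  a *: (A *m C + D *m E) + b *: (B *m C + D *m F) =
  (a *: A + b *: B) *m C + D *m (a *: E + b *: F).
Proof.
by rewrite mulmxDl mulmxDr !scalerDr -!scalemxAl -!scalemxAr addrACA.
Qed.

Lemma vdmxM (F G : spacetime -> mat) w : mdiff F w -> mdiff G w ->
  vdmx (fun x => F x *m G x) w = vdmx F w *m G w + F w *m vdmx G w.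
Proof.
by move=> dF dG; rewrite /vdmx !dmxM //; exact: scale_leibniz.
Qed.

Lemma vdmxB (F G : spacetime -> mat) w : mdiff F w -> mdiff G w ->
  vdmx (fun x => F x - G x) w = vdmx F w - vdmx G w.
Proof.
by move=> dF dG; rewrite /vdmx !dmxB // !scalerBr opprD addrACA.
Qed.

Lemma commx_leibniz (A B C D : mat) :
  A *m D + B *m C - (C *m B + D *m A) = commx A D + commx B C.
Proof. by rewrite /commx [C *m B + _]addrC opprD addrACA. Qed.

Lemma vdmx_comm (F G : spacetime -> mat) w : mdiff F w -> mdiff G w ->
  vdmx (fun x => commx (F x) (G x)) w = commx (vdmx F w) (G w) + commx (F w) (vdmx G w).
Proof.
move=> dF dG; rewrite vdmxB; try exact: mdiffM.
rewrite !vdmxM //; exact: commx_leibniz.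
Qed.

Lemma vdmx_rapid I F : open I -> rapid I F -> rapid I (vdmx F).
Proof. by move=> oI rF; apply: (rapidD oI); apply: (rapidZ oI); exact: rapid_dmx. Qed.

Lemma trint_vdmx I F t : open I -> rapid I F -> I t -> trint (vdmx F) t = 0.
Proof.
move=> oI rF It; have rx := rapid_dmx (st_x R) rF; have ry := rapid_dmx (st_y R) rF.
have Ex := etrans (trintZ (cos theta) rx It) (etrans (congr1 _ (trint_dx rF It)) (mulr0 _)).
have Ey := etrans (trintZ (sin theta) ry It) (etrans (congr1 _ (trint_dy rF It)) (mulr0 _)).
exact: (etrans (trintD (rapidZ oI _ rx) (rapidZ oI _ ry) It) (etrans (congr2 +%R Ex Ey) (addr0 0))).
Qed.

Lemma commDl (A B C : mat) : commx (A + B) C = commx A C + commx B C.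
Proof. by rewrite /commx mulmxDl mulmxDr opprD addrACA. Qed.

Lemma commZl (a : R[i]) (A C : mat) : commx (a *: A) C = a *: commx A C.
Proof. by rewrite /commx -scalemxAl -scalemxAr scalerBr. Qed.

Lemma scale_comm_add (a b : R[i]) (A B D E C : mat) :
  a *: (A + commx D C) + b *: (B + commx E C) =
  (a *: A + b *: B) + commx (a *: D + b *: E) C.
Proof. by rewrite commDl !commZl !scalerDr addrACA. Qed.

(** Flatness in the directions t and v, where v combines the two space
    directions linearly. *)
Lemma vpotential_flat I Q w : open I -> rapid I (fun w => Q w - 1%:M) ->
  (forall w, I w.1 -> Q w \is unitarymx) -> I w.1 ->
  dmx (st_t R) (vpotential Q) w =
  vdmx (potential Q (st_t R)) w + commx (vpotential Q w) (potential Q (st_t R) w).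
Proof.
move=> oI rQ uQ Iw.
have mL v : mdiff (potential Q v) w by exact: (decay_mdiff (potential_rapid oI rQ v 0%N)).
have Ex := etrans (dmxZ (st_t R) (cos theta)%:C (mL (st_x R)))
  (congr1 _ (potential_flat oI rQ uQ (st_t R) (st_x R) Iw)).
have Ey := etrans (dmxZ (st_t R) (sin theta)%:C (mL (st_y R)))
  (congr1 _ (potential_flat oI rQ uQ (st_t R) (st_y R) Iw)).
have E := dmxD (st_t R) (mdiffZ (cos theta)%:C (mL (st_x R)))
  (mdiffZ (sin theta)%:C (mL (st_y R))).
exact: (etrans E (etrans (congr2 +%R Ex Ey) (scale_comm_add _ _ _ _ _ _ _))).
Qed.

Lemma dmx_slice_eq (F : spacetime -> mat) (f : plane -> mat) t (v z : plane) :
  (forall x, F (t, x) = f x) -> dmx (0, v) F (t, z) = dmx v f z.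
Proof. by move=> Ff; rewrite dmx_slice; congr (dmx v _ z); exact/funext. Qed.

Section Variation.
Variables (m X : fields) (I : set R) (c : R -> fields).
Hypothesis mc : curve_at m X I c.

(** Derivatives in space directions depend only on the time slice, so along a
    curve through m they are those of m. *)
Lemma curve_at_spatial v z : potential (pos c) (0, v) (0, z) =
  potential (pos (fun=> m)) (0, v) (0, z).
Proof.
by rewrite /potential (curve_at_pos mc) (dmx_slice_eq v z (curve_at_pos mc)).
Qed.

Lemma curve_at_vpotential z :
  vpotential (pos c) (0, z) = vpotential (pos (fun=> m)) (0, z).
Proof. by rewrite /vpotential !curve_at_spatial. Qed.

Lemma curve_at_dpotential v z :
  dmx (st_t R) (potential (pos c) (0, v)) (0, z) =
  dmx (0, v) (pos (fun=> X)) (0, z) +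
  commx (potential (pos (fun=> m)) (0, v) (0, z)) (X.2 z).
Proof.
have oI := curve_at_open mc; have I0 := curve_at0 mc; have pc := curve_at_phase mc.
rewrite (potential_flat oI (phase_pos pc) (phase_unitary pc) (st_t R) _ (w := (0, z)) I0).
by rewrite curve_at_spatial (curve_at_potential mc)
  (dmx_slice_eq v z (curve_at_potential mc)).
Qed.

Lemma curve_at_dvpotential z :
  dmx (st_t R) (vpotential (pos c)) (0, z) =
  vdmx (pos (fun=> X)) (0, z) + commx (vpotential (pos (fun=> m)) (0, z)) (X.2 z).
Proof.
have oI := curve_at_open mc; have I0 := curve_at0 mc; have pc := curve_at_phase mc.
rewrite (vpotential_flat oI (phase_pos pc) (phase_unitary pc) (w := (0, z)) I0).
rewrite curve_at_vpotential (curve_at_potential mc).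
by rewrite /vdmx !(dmx_slice_eq _ z (curve_at_potential mc)).
Qed.
End Variation.

(** The rate of change of u - p at m along a curve with velocity X. *)
Definition variation m X (w : spacetime) : mat :=
  vdmx (pos (fun=> X)) w + commx (vpotential (pos (fun=> m)) w) (pos (fun=> X) w)
  - mom (fun=> X) w.

Lemma variation_rapid m X : phase m -> tangent X -> rapid setT (variation m X).
Proof.
move=> pm tX; have rX2 := tangent_pos (tangent_cst setT tX).
apply: (rapidB openT); last exact: (tangent_mom (tangent_cst setT tX)).
apply: (rapidD openT); first exact: (vdmx_rapid openT rX2).
exact: (rapid_comm openT (vpotential_rapid theta openT (phase_cst setT pm)) rX2).
Qed.

(** Only u - p varies along the curve, the tangent vectors being left-
    invariant. *)
Lemma is_dirderiv_ward m X Y Z : phase m -> tangent X -> tangent Y -> tangent Z ->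
  is_dirderiv (fun m' => ward_form theta m' Y Z) m X
    (trint (fun w => variation m X w *m commx (pos (fun=> Y) w) (pos (fun=> Z) w)) 0).
Proof.
move=> pm tX tY tZ; apply: is_dirderiv_intro => // I c mc.
have oI := curve_at_open mc; have I0 := curve_at0 mc; have pc := curve_at_phase mc.
have cY := tangent_cst I tY; have cZ := tangent_cst I tZ.
have rapid' := ward_density_rapid theta oI pc (tangent_mom cY) (tangent_pos cY)
  (tangent_mom cZ) (tangent_pos cZ).
have D := is_derive_trint oI rapid' I0.
apply: (@near_eq_is_derive _ _ _ (trint (ward_density theta c (mom (fun=> Y)) (pos (fun=> Y))
  (mom (fun=> Z)) (pos (fun=> Z))))).
  apply: filterS (open_nbhs_nbhs (conj oI I0)) => s Is.
  by rewrite -(ward_formE theta oI pc cY cZ Is).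
suff <- : trint (dmx (st_t R) (ward_density theta c (mom (fun=> Y)) (pos (fun=> Y))
  (mom (fun=> Z)) (pos (fun=> Z)))) 0 =
  trint (fun w => variation m X w *m commx (pos (fun=> Y) w) (pos (fun=> Z) w)) 0 by [].
apply: eq_trint => z; congr retr.
have mP := decay_mdiff (phase_mom pc 0%N) (w := (0, z)) I0.
have mU := decay_mdiff (vpotential_rapid theta oI pc 0%N) (w := (0, z)) I0.
have mY2 := decay_mdiff (tangent_pos cY 0%N) (w := (0, z)) I0.
have mZ2 := decay_mdiff (tangent_pos cZ 0%N) (w := (0, z)) I0.
have mY1 := decay_mdiff (tangent_mom cY 0%N) (w := (0, z)) I0.
have mZ1 := decay_mdiff (tangent_mom cZ 0%N) (w := (0, z)) I0.
have mC : mdiff (fun w => commx (pos (fun=> Y) w) (pos (fun=> Z) w)) (0, z).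
  by apply: mdiffB; exact: mdiffM.
rewrite dmxD; [|by apply: mdiffB; exact: mdiffM|by apply: mdiffM => //; exact: mdiffB].
rewrite (dmx_t_snd (fun x => Y.1 x *m Z.2 x - Z.1 x *m Y.2 x)) add0r.
rewrite dmxM //; last exact: mdiffB.
rewrite (dmx_t_snd (fun x => commx (Y.2 x) (Z.2 x))) mulmx0 addr0.
by rewrite dmxB // (curve_at_dvpotential mc) (curve_at_dmom mc).
Qed.

Lemma eq_alternating6 (a b c d e f a' b' c' d' e' f' : R) :
  a = a' -> b = b' -> c = c' -> d = d' -> e = e' -> f = f' ->
  a - b + c - d + e - f = a' - b' + c' - d' + e' - f'.
Proof. by move=> -> -> -> -> -> ->. Qed.

Lemma trint_alternating6 (A B C D E F : spacetime -> mat) :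
  rapid setT A -> rapid setT B -> rapid setT C -> rapid setT D -> rapid setT E -> rapid setT F ->
  trint A 0 - trint B 0 + trint C 0 - trint D 0 + trint E 0 - trint F 0 =
  trint (fun w => A w - B w + C w - D w + E w - F w) 0.
Proof.
move=> rA rB rC rD rE rF.
have r1 := rapidB openT rA rB; have r2 := rapidD openT r1 rC.
have r3 := rapidB openT r2 rD; have r4 := rapidD openT r3 rE.
by rewrite (trintB openT r4 rF) // (trintD r3 rE) // (trintB openT r2 rD) //
  (trintD r1 rC) // (trintB openT rA rB).
Qed.

Lemma retr_alternating6 (A B C D E F : mat) :
  retr (A - B + C - D + E - F) = retr A - retr B + retr C - retr D + retr E - retr F.
Proof. by rewrite retrB retrD retrB retrD retrB. Qed.

Lemma ward_closed : closed_form (@ward_form R n theta).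
Proof.
move=> m X Y Z pm tX tY tZ; split.
  by eexists; exact: is_dirderiv_ward.
have tXY := tangent_bracket tX tY; have tXZ := tangent_bracket tX tZ.
have tYZ := tangent_bracket tY tZ.
have pc := phase_cst setT pm.
have T A B C : tangent A -> tangent B -> tangent C ->
    rapid setT (fun w => variation m A w *m commx (pos (fun=> B) w) (pos (fun=> C) w)).
  move=> tA tB tC; apply: (rapidMl openT); first exact: variation_rapid.
  by apply: rapid_bounded; apply: (rapid_comm openT); apply: tangent_pos; exact: tangent_cst.
have W A B : tangent A -> tangent B -> rapid setT (ward_density theta (fun=> m)
    (mom (fun=> A)) (pos (fun=> A)) (mom (fun=> B)) (pos (fun=> B))).
  move=> tA tB; apply: (ward_density_rapid _ openT pc);
    by [apply: tangent_mom; exact: tangent_cst|apply: tangent_pos; exact: tangent_cst].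
have T1 := T _ _ _ tX tY tZ; have T2 := T _ _ _ tY tX tZ; have T3 := T _ _ _ tZ tX tY.
have W1 := W _ _ tXY tZ; have W2 := W _ _ tXZ tY; have W3 := W _ _ tYZ tX.
rewrite /ext_deriv2.
apply: (etrans (eq_alternating6
  (dirderivE (is_dirderiv_ward pm tX tY tZ)) (dirderivE (is_dirderiv_ward pm tY tX tZ))
  (dirderivE (is_dirderiv_ward pm tZ tX tY)) (ward_form_static theta pm tXY tZ)
  (ward_form_static theta pm tXZ tY) (ward_form_static theta pm tYZ tX))).
apply: (etrans (trint_alternating6 T1 T2 T3 W1 W2 W3)).
have rx := tangent_pos (tangent_cst setT tX).
have ry := tangent_pos (tangent_cst setT tY).
have rz := tangent_pos (tangent_cst setT tZ).
have rG : rapid setT (fun w => pos (fun=> X) w *m commx (pos (fun=> Y) w) (pos (fun=> Z) w)).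
  by apply: (rapidMl openT) => //; apply: rapid_bounded; exact: (rapid_comm openT).
apply: etrans (trint_vdmx (t := 0) openT rG Logic.I); apply: eq_trint => z.
have mx := decay_mdiff (rx 0%N) (w := (0, z)) Logic.I.
have my := decay_mdiff (ry 0%N) (w := (0, z)) Logic.I.
have mz := decay_mdiff (rz 0%N) (w := (0, z)) Logic.I.
rewrite vdmxM //; last by apply: mdiffB; exact: mdiffM.
rewrite vdmx_comm //.
exact: (etrans (retr_alternating6 _ _ _ _ _ _)
  (@trace_closed R mat (@retr R n) (@retrD R n) (@retrN R n) (@retrC R n) _ _ _ _ _ _ _ _ _ _ _)).
Qed.

Lemma trint_skew_sqr_eq0 (A : spacetime -> mat) t : rapid setT A ->
  (forall w, skewhermmx (A w)) -> trint (fun w => A w *m A w) t = 0 -> forall z, A (t, z) = 0.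
Proof.
move=> rA sA E; apply: (trint_adj_eq0 openT rA Logic.I).
rewrite (_ : trint _ t = trint (fun w => - (A w *m A w)) t).
  by rewrite (trintN (rapidMl openT rA (rapid_bounded rA)) Logic.I) E oppr0.
by apply: eq_trint => z; rewrite sA mulmxN.
Qed.

(** The test vectors are (X2, 0) and then (0, X1). *)
Lemma ward_weakly_nondegenerate : weakly_nondegenerate (@ward_form R n theta).
Proof.
move=> m X pm tX H.
have t0 := tangent0 tX.
have a0 : algebra_map (fun=> 0 : mat) by case: t0.
have rX1 := tangent_mom (tangent_cst setT tX); have rX2 := tangent_pos (tangent_cst setT tX).
have X2z : forall z, X.2 z = 0.
  move=> z; apply: (@trint_skew_sqr_eq0 (pos (fun=> X)) 0 rX2 _ _ z).
    by move=> w; case: tX => _ [] _; apply.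
  have tY : tangent (X.2, (fun=> 0) : plane -> mat) by split=> //; case: tX.
  have := H _ tY; rewrite ward_form_static // => E.
  have cY := tangent_cst setT tY.
  have rW := ward_density_rapid theta openT (phase_cst setT pm) rX1 rX2 (tangent_mom cY) (tangent_pos cY).
  have EN := trintN (t := 0) rW Logic.I; rewrite E oppr0 in EN; apply: etrans EN.
  apply: eq_trint => w; congr retr.
  by rewrite /ward_density /commx /mom /pos /= !mulmx0 mul0mx subr0 mulmx0 addr0 sub0r opprK.
have X1z : forall z, X.1 z = 0.
  move=> z; apply: (@trint_skew_sqr_eq0 (mom (fun=> X)) 0 rX1 _ _ z).
    by move=> w; case: tX => [[] _ + _]; apply.
  have tY : tangent (((fun=> 0) : plane -> mat), X.1) by split=> //; case: tX.
  have := H _ tY; rewrite ward_form_static // => E; apply: etrans E.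
  apply: eq_trint => w; congr retr.
  by rewrite /ward_density /commx /mom /pos /= !X2z !(mul0mx, mulmx0, subr0, addr0).
by case: X X1z X2z {H tX rX1 rX2} => X1 X2 /= h1 h2; congr pair; apply/funext.
Qed.

Lemma ward_symplectic : symplectic_form (@ward_form R n theta).
Proof.
split; [exact: ward_is_two_form|exact: ward_closed|exact: ward_weakly_nondegenerate].
Qed.

End Symplectic.

(** * The Hamiltonian vector field *)

Section Hamiltonian.
Variables (R : realType) (n : nat) (theta : R).
Local Notation mat := 'M[R[i]]_n.
Local Notation plane := (R * R)%type.
Local Notation spacetime := (R * (R * R))%type.
Local Notation fields := (fields R n).
Local Notation potential := (@potential R n).
Local Notation vpotential := (vpotential theta).
Implicit Types (I : set R) (m X Y Z : fields) (t : R).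

Definition divergence (Q : spacetime -> mat) (w : spacetime) : mat :=
  dmx (st_x R) (potential Q (st_x R)) w + dmx (st_y R) (potential Q (st_y R)) w.

(** The value that the flow prescribes for the derivative of p. *)
Definition force (c : R -> fields) (w : spacetime) : mat :=
  divergence (pos c) w + commx (mom c w) (vpotential (pos c) w).

(** The components solve dH(Y) = w(Y, X_H) for all Y; see the trace identity
    used in ward_form_field. *)
Definition ward_field m : fields :=
  (fun z => dmx (dir_x R) (logder (dir_x R) m.2) z
            + dmx (dir_y R) (logder (dir_y R) m.2) z
            + commx (m.1 z) (invmx (m.2 z) *m
                ((cos theta)%:C *: dmx (dir_x R) m.2 z +
                 (sin theta)%:C *: dmx (dir_y R) m.2 z)),
   m.1).

Lemma logder_slice I c t v x : phase_curve I c -> I t ->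
  potential (pos c) (0, v) (t, x) = logder v (c t).2 x.
Proof.
move=> pc It; have u := phase_unitary pc (w := (t, x)) It.
by rewrite /logder (invmx_unitary u) /potential dmx_slice.
Qed.

Lemma ward_field_force I c t z : phase_curve I c -> I t ->
  (ward_field (c t)).1 z = force c (t, z).
Proof.
move=> pc It; rewrite /ward_field /= (vpotential_slice theta z pc It) /force.
have E v : dmx v (logder v (c t).2) z = dmx (0, v) (potential (pos c) (0, v)) (t, z).
  by symmetry; apply: dmx_slice_eq => x; exact: (logder_slice v x pc It).
by rewrite (E (dir_x R)) (E (dir_y R)).
Qed.

Lemma divergence_rapid I c : open I -> phase_curve I c -> rapid I (divergence (pos c)).
Proof.
move=> oI pc.
by apply: (rapidD oI); apply: rapid_dmx; exact: (potential_rapid oI (phase_pos pc)).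
Qed.

Lemma force_rapid I c : open I -> phase_curve I c -> rapid I (force c).
Proof.
move=> oI pc; apply: (rapidD oI (divergence_rapid oI pc)).
exact: (rapid_comm oI (phase_mom pc) (vpotential_rapid theta oI pc)).
Qed.

Lemma force_skew I c w : open I -> phase_curve I c -> I w.1 -> skewhermmx (force c w).
Proof.
move=> oI pc Iw.
have sL v x : I x.1 -> skewhermmx (potential (pos c) v x).
  exact: (potential_skew oI (phase_pos pc) (phase_unitary pc)).
have mL v : mdiff (potential (pos c) v) w.
  exact: (decay_mdiff (potential_rapid oI (phase_pos pc) v 0%N)).
have sd v u : skewhermmx (dmx u (potential (pos c) v) w).
  exact: (dmx_skew oI u (sL v) (mL v) Iw).
apply: skewD; first by apply: skewD; exact: sd.
apply: skew_comm; first by case: pc => [[_ +] _]; case: w Iw {mL sd} => t z /= It; apply.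
by apply: skewD; apply: skewZ; exact: sL.
Qed.

Lemma ward_field_smooth : smooth_vector_field ward_field.
Proof.
have main I c : open I -> phase_curve I c -> tangent_curve I (ward_field \o c).
  move=> oI pc; split; last by case: pc.
  split.
    apply/rapidly_decaying_curveP; apply: (eq_rapid oI) (force_rapid oI pc).
    by move=> [t z] It; rewrite -(ward_field_force z pc It).
  move=> t It z; rewrite [X in skewhermmx X](ward_field_force z pc It).
  exact: (force_skew oI pc (w := (t, z)) It).
split=> [m pm|I c oI _]; last exact: main.
exact: (tangent_slice (t := 0) (main setT (fun=> m) openT (phase_cst setT pm)) Logic.I).
Qed.

Definition energy (c : R -> fields) (w : spacetime) : mat :=
  mom c w *m mom c w +
  (potential (pos c) (st_x R) w *m potential (pos c) (st_x R) w +
   potential (pos c) (st_y R) w *m potential (pos c) (st_y R) w).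

Lemma energy_rapid I c : open I -> phase_curve I c -> rapid I (energy c).
Proof.
move=> oI pc.
have sq F : rapid I F -> rapid I (fun w => F w *m F w :> mat).
  by move=> rF; exact: (rapidMl oI rF (rapid_bounded rF)).
apply: (rapidD oI (sq _ (phase_mom pc))).
by apply: (rapidD oI); apply: sq; exact: (potential_rapid oI (phase_pos pc)).
Qed.

Lemma hamiltonian_energy I c t : phase_curve I c -> I t ->
  hamiltonian (c t) = 2^-1 * trint (energy c) t.
Proof.
move=> pc It; congr (_ * _); congr integral_plane; apply/funext => z.
rewrite /energy retrD retrD.
by rewrite (logder_slice (dir_x R) z pc It) (logder_slice (dir_y R) z pc It).
Qed.

(** The integrand of dH once the divergences of energy_flux are discarded. *)
Definition energy_gradient m Y (w : spacetime) : mat :=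
  mom (fun=> m) w *m mom (fun=> Y) w - divergence (pos (fun=> m)) w *m pos (fun=> Y) w.

Definition energy_flux m Y v (w : spacetime) : mat :=
  potential (pos (fun=> m)) v w *m pos (fun=> Y) w.

Lemma energy_gradient_rapid m Y : phase m -> tangent Y -> rapid setT (energy_gradient m Y).
Proof.
move=> pm tY; have pc := phase_cst setT pm; have cY := tangent_cst setT tY.
apply: (rapidB openT).
  exact: (rapidMl openT (phase_mom pc) (rapid_bounded (tangent_mom cY))).
exact: (rapidMl openT (divergence_rapid openT pc) (rapid_bounded (tangent_pos cY))).
Qed.

Lemma energy_flux_rapid m Y v : phase m -> tangent Y -> rapid setT (energy_flux m Y v).
Proof.
move=> pm tY; have pc := phase_cst setT pm; have cY := tangent_cst setT tY.
exact: (rapidMl openT (potential_rapid openT (phase_pos pc) v) (rapid_bounded (tangent_pos cY))).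
Qed.

Lemma trint_energy_gradient m Y : phase m -> tangent Y ->
  trint (fun w => energy_gradient m Y w +
    (dmx (st_x R) (energy_flux m Y (st_x R)) w + dmx (st_y R) (energy_flux m Y (st_y R)) w)) 0
  = trint (energy_gradient m Y) 0.
Proof.
move=> pm tY; have rG := energy_gradient_rapid pm tY.
have rx := energy_flux_rapid (st_x R) pm tY; have ry := energy_flux_rapid (st_y R) pm tY.
have dx := rapid_dmx (st_x R) rx; have dy := rapid_dmx (st_y R) ry.
apply: (etrans (trintD (t := 0) rG (rapidD openT dx dy) Logic.I)).
apply: etrans (addr0 _); congr (_ + _).
apply: (etrans (trintD (t := 0) dx dy Logic.I)).
exact: (etrans (congr2 +%R (trint_dx (t := 0) rx Logic.I) (trint_dy (t := 0) ry Logic.I)) (addr0 0)).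
Qed.

Lemma ward_form_field m Y : phase m -> tangent Y ->
  ward_form theta m Y (ward_field m) = trint (energy_gradient m Y) 0.
Proof.
move=> pm tY; have tF := ward_field_smooth.1 m pm.
apply: (etrans (ward_form_static theta pm tY tF)); apply: eq_trint => z.
have F := ward_field_force (t := 0) z (phase_cst setT pm) Logic.I.
rewrite -[ward_density _ _ _ _ _ _ _]/(Y.1 z *m m.1 z - (ward_field m).1 z *m Y.2 z +
  (vpotential (pos (fun=> m)) (0, z) - m.1 z) *m commx (Y.2 z) (m.1 z)) F.
exact: (@trace_hamilton R mat (@retr R n) (@retrD R n) (@retrN R n) (@retrC R n)).
Qed.

(** By flatness L_a varies by d_a Y2 + [L_a, Y2], whose second term is
    orthogonal to L_a; tr (L_a d_a Y2) is - tr (d_a L_a Y2) up to a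
    divergence. Adding the divergences back, with zero integral, makes the two
    integrands equal pointwise. *)
Lemma is_dirderiv_hamiltonian m Y : phase m -> tangent Y ->
  is_dirderiv (@hamiltonian R n) m Y (ward_form theta m Y (ward_field m)).
Proof.
move=> pm tY; rewrite ward_form_field // -trint_energy_gradient //.
apply: is_dirderiv_intro => // I c mc.
have oI := curve_at_open mc; have I0 := curve_at0 mc; have pc := curve_at_phase mc.
have D := is_derive_trint oI (energy_rapid oI pc) I0.
apply: (@near_eq_is_derive _ _ _ (2^-1 *: trint (energy c))).
  apply: filterS (open_nbhs_nbhs (conj oI I0)) => s Is.
  by rewrite /= (hamiltonian_energy pc Is).
set G := (X in trint X 0).
have rG : rapid setT G.
  apply: (rapidD openT (energy_gradient_rapid pm tY)); apply: (rapidD openT); apply: rapid_dmx;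
    exact: energy_flux_rapid.
suff E : trint (dmx (st_t R) (energy c)) 0 = 2 * trint G 0.
  have -> : trint G 0 = 2^-1 *: trint (dmx (st_t R) (energy c)) 0.
    by rewrite E /GRing.scale /= mulKf.
  exact: is_deriveZ.
apply: etrans (trintZ 2 (t := 0) rG Logic.I); apply: eq_trint => z.
have mP := decay_mdiff (phase_mom pc 0%N) (w := (0, z)) I0.
have mL v := decay_mdiff (potential_rapid oI (phase_pos pc) (0, v) 0%N) (w := (0, z)) I0.
have mL0 v := decay_mdiff (potential_rapid openT (phase_pos (phase_cst setT pm)) (0, v) 0%N)
  (w := (0, z)) Logic.I.
have mY := decay_mdiff (tangent_pos (tangent_cst setT tY) 0%N) (w := (0, z)) Logic.I.
have EP : dmx (st_t R) (fun w => mom c w *m mom c w) (0, z) =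
    Y.1 z *m m.1 z + m.1 z *m Y.1 z.
  by rewrite dmxM // (curve_at_dmom mc) (curve_at_mom mc).
have EL v : retr (dmx (st_t R) (fun w => potential (pos c) (0, v) w *m
     potential (pos c) (0, v) w) (0, z)) =
   2 * retr (potential (pos (fun=> m)) (0, v) (0, z) *m dmx (0, v) (pos (fun=> Y)) (0, z)).
  rewrite dmxM // retrD (retrC (dmx _ _ _)) (curve_at_dpotential mc) (curve_at_spatial mc).
  rewrite (@trace_comm_self R mat (@retr R n) (@retrD R n) (@retrN R n) (@retrC R n)).
  by rewrite mulr_natl mulr2n.
have EF v : dmx (0, v) (energy_flux m Y (0, v)) (0, z) =
   dmx (0, v) (potential (pos (fun=> m)) (0, v)) (0, z) *m Y.2 z +
   potential (pos (fun=> m)) (0, v) (0, z) *m dmx (0, v) (pos (fun=> Y)) (0, z).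
  exact: dmxM.
have EE : retr (dmx (st_t R) (energy c) (0, z)) =
   retr (Y.1 z *m m.1 z + m.1 z *m Y.1 z) +
   (2 * retr (potential (pos (fun=> m)) (st_x R) (0, z) *m dmx (st_x R) (pos (fun=> Y)) (0, z)) +
    2 * retr (potential (pos (fun=> m)) (st_y R) (0, z) *m dmx (st_y R) (pos (fun=> Y)) (0, z))).
  have mS v := mdiffM (mL v) (mL v).
  have E1 := etrans (dmxD (st_t R) (mdiffM mP mP) (mdiffD (mS (dir_x R)) (mS (dir_y R))))
    (congr1 _ (dmxD (st_t R) (mS (dir_x R)) (mS (dir_y R)))).
  exact: (etrans (congr1 (@retr R n) E1) (etrans (retrD _ _) (congr2 +%R (congr1 _ EP)
    (etrans (retrD _ _) (congr2 +%R (EL (dir_x R)) (EL (dir_y R))))))).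
apply: (etrans EE).
apply: (etrans (@trace_energy R mat (@retr R n) (@retrD R n) (@retrN R n) (@retrC R n)
  _ _ _ _ (dmx (st_x R) (potential (pos (fun=> m)) (st_x R)) (0, z))
  (dmx (st_y R) (potential (pos (fun=> m)) (st_y R)) (0, z)) (Y.2 z) _ _)).
apply: esym; apply: (etrans (retrZ 2 _)).
exact: (congr1 (fun A => 2 * retr (energy_gradient m Y (0, z) + A))
  (congr2 +%R (EF (dir_x R)) (EF (dir_y R)))).
Qed.

End Hamiltonian.

(** * The Ward equation *)

Section WardEquation.
Variables (R : realType) (n : nat) (theta : R).
Local Notation mat := 'M[R[i]]_n.
Local Notation plane := (R * R)%type.
Local Notation spacetime := (R * (R * R))%type.
Local Notation fields := (fields R n).
Local Notation potential := (@potential R n).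
Local Notation vpotential := (vpotential theta).
Local Notation omega := (@ward_form R n theta).
Implicit Types (I : set R) (m X Y Z : fields) (t : R).

Lemma ward_field_hamiltonian :
  hamiltonian_vector_field omega (@hamiltonian R n) (ward_field theta).
Proof. by split; [exact: ward_field_smooth|exact: is_dirderiv_hamiltonian]. Qed.

(** Two such fields differ by a vector that the 2-form annihilates. *)
Lemma hamiltonian_field_unique (X : fields -> fields) :
  hamiltonian_vector_field omega (@hamiltonian R n) X ->
  forall m, phase m -> X m = ward_field theta m.
Proof.
move=> [[tX _] HX] m pm; have [lin anti _] := @ward_is_two_form R n theta.
have tm := tX m pm; have tW := (@ward_field_smooth R n theta).1 m pm.
have E Y : tangent Y -> omega m Y (X m) = omega m Y (ward_field theta m).
  move=> tY; exact: (is_dirderiv_unique (HX m Y pm tY) (is_dirderiv_hamiltonian theta pm tY)).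
have : (-1)%:C *: ward_field theta m + X m = 0.
  apply: (@ward_weakly_nondegenerate R n theta m) => //; first exact: tangent_lin.
  move=> Y tY; rewrite lin // anti // (anti m pm (X m)) // E //.
  by rewrite mulN1r addNr.
rewrite (_ : (-1)%:C = -1); last by apply: complex_eq; rewrite ?ReN ?ImN //= oppr0.
by rewrite scaleN1r addrC => /eqP; rewrite subr_eq0 => /eqP.
Qed.

Lemma commx_conj (A B C q r : mat) (a b : R[i]) : r *m q = 1%:M ->
  commx (q *m A *m r) (a *: (q *m B *m r) + b *: (q *m C *m r)) =
  q *m commx A (a *: B + b *: C) *m r.
Proof.
move=> rq.
have E : a *: (q *m B *m r) + b *: (q *m C *m r) = q *m (a *: B + b *: C) *m r.
  by rewrite mulmxDr mulmxDl -!scalemxAr -!scalemxAl.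
rewrite {}E; move: (a *: B + b *: C) => {B C}D.
have key (M N : mat) : q *m M *m r *m (q *m N *m r) = q *m (M *m N) *m r.
  by rewrite !mulmxA -(mulmxA _ r q) rq mulmx1.
by rewrite /commx !key -mulmxBl -mulmxBr.
Qed.

Lemma conj_sum (A B C D q r : mat) :
  - (q *m A *m r) + q *m B *m r + q *m C *m r + q *m D *m r =
  q *m (- A + B + C + D) *m r.
Proof. by rewrite !mulmxDr !mulmxDl mulmxN mulNmx. Qed.

Lemma conj_eq0 (A B C D q r : mat) : r *m q = 1%:M ->
  q *m (- A + B + C + D) *m r = 0 <-> A = B + C + D.
Proof.
move=> rq; rewrite -!addrA; move: (B + _) => {B C D}M.
split=> [E|->]; last by rewrite addNr mulmx0 mul0mx.
have : r *m (q *m (- A + M) *m r) *m q = - A + M.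
  by rewrite !mulmxA rq mul1mx -mulmxA rq mulmx1.
by rewrite E mulmx0 mul0mx addrC => /esym/eqP; rewrite subr_eq0 => /eqP.
Qed.

Section Gauge.
Variables (I : set R) (Q : spacetime -> mat).
Hypothesis oI : open I.
Hypothesis rQ : rapid I (fun w => Q w - 1%:M).
Hypothesis uQ : forall w, I w.1 -> Q w \is unitarymx.

(** A commutator of conjugates is the conjugate of the commutator, so every
    term is a conjugate by Q once dmx_rpotential is applied. *)
Lemma ward_expression w : I w.1 ->
  - dmx (st_t R) (rpotential Q (st_t R)) w
  + dmx (st_x R) (rpotential Q (st_x R)) w
  + dmx (st_y R) (rpotential Q (st_y R)) w
  + commx (rpotential Q (st_t R) w)
      ((cos theta)%:C *: rpotential Q (st_x R) w
       + (sin theta)%:C *: rpotential Q (st_y R) w) =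
  Q w *m (- dmx (st_t R) (potential Q (st_t R)) w
     + dmx (st_x R) (potential Q (st_x R)) w + dmx (st_y R) (potential Q (st_y R)) w
     + commx (potential Q (st_t R) w) (vpotential Q w)) *m (Q w) ^t*.
Proof.
move=> Iw; have dE v := dmx_rpotential oI rQ uQ v Iw.
have rE v := rpotentialE uQ v Iw.
have QQ := unitary_adjM (uQ Iw).
apply: etrans (conj_sum _ _ _ _ _ _).
apply: (congr2 +%R (congr2 +%R (congr2 +%R (congr1 -%R (dE _)) (dE _)) (dE _))).
apply: etrans (commx_conj _ _ _ _ _ QQ).
exact: (congr2 (@commx R n) (rE _) (congr2 +%R (congr1 _ (rE _)) (congr1 _ (rE _)))).
Qed.

Lemma ward_expression_eq0 w : I w.1 ->
  (- dmx (st_t R) (rpotential Q (st_t R)) w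
  + dmx (st_x R) (rpotential Q (st_x R)) w
  + dmx (st_y R) (rpotential Q (st_y R)) w
  + commx (rpotential Q (st_t R) w)
      ((cos theta)%:C *: rpotential Q (st_x R) w
       + (sin theta)%:C *: rpotential Q (st_y R) w) = 0) <->
  dmx (st_t R) (potential Q (st_t R)) w =
  divergence Q w + commx (potential Q (st_t R) w) (vpotential Q w).
Proof.
by move=> Iw; rewrite (ward_expression Iw); exact: (conj_eq0 _ _ _ _ (unitary_adjM (uQ Iw))).
Qed.
End Gauge.

Lemma integral_curve_ward (X : fields -> fields) I (p q : R -> plane -> mat) :
  hamiltonian_vector_field omega (@hamiltonian R n) X -> open I ->
  integral_curve I X (fun t => (p t, q t)) <->
  [/\ group_curve I q, forall t, I t -> p t = logder_t q t & ward_equation theta I q].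
Proof.
move=> HX oI; set c := fun t => (p t, q t).
have XE := hamiltonian_field_unique HX.
have near_mom w : (forall x, I x.1 -> mom c x = potential (pos c) (st_t R) x) -> I w.1 ->
    dmx (st_t R) (mom c) w = dmx (st_t R) (potential (pos c) (st_t R)) w.
  move=> E Iw; apply: near_eq_dmx.
  by apply: filterS (near_slab oI Iw) => x; exact: E.
split=> [[pc V]|[gq pE W]].
- have [_ gq] := pc.
  have VE t : I t -> velocity c t = ward_field theta (c t).
    by move=> It; rewrite V // XE //; exact: phase_slice pc It.
  have pE t : I t -> p t = logder_t q t.
    by move=> /VE /(congr1 snd).
  split => // t It z.
  have uw := phase_unitary pc; have rq := phase_pos pc.
  apply/(ward_expression_eq0 oI rq uw (w := (t, z)) It).
  have mE x : I x.1 -> mom c x = potential (pos c) (st_t R) x.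
    case: x => s y /= Is; rewrite /mom /= (pE s Is) /logder_t.
    by rewrite (invmx_unitary (uw (s, y) Is)).
  rewrite -(near_mom (t, z) mE It).
  have /(congr1 fst)/(congr1 (fun f => f z)) /= := VE t It.
  rewrite -[LHS]/(dmx (st_t R) (mom c) (t, z)) => ->.
  rewrite -[LHS]/((ward_field theta (c t)).1 z) (ward_field_force theta z pc It) /force.
  by rewrite (mE (t, z) It).
- have rq : rapid I (fun w => pos c w - 1%:M) by case: gq => /rapidly_decaying_curveP.
  have uw w : I w.1 -> pos c w \is unitarymx by move=> Iw; apply: gq.2.
  have mE x : I x.1 -> mom c x = potential (pos c) (st_t R) x.
    case: x => s y /= Is; rewrite /mom /= (pE s Is) /logder_t.
    by rewrite (invmx_unitary (uw (s, y) Is)).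
  have pc : phase_curve I c.
    split=> //; split.
      apply/rapidly_decaying_curveP.
      apply: (eq_rapid oI) (potential_rapid oI rq (st_t R)) => w Iw.
      by rewrite -(mE w Iw).
    move=> t It z; rewrite [X in skewhermmx X](mE (t, z) It).
    exact: (potential_skew oI rq uw (st_t R) (w := (t, z)) It).
  split=> // t It; rewrite XE; last exact: phase_slice pc It.
  congr pair; last by rewrite -pE.
  apply/funext => z.
  apply: etrans (esym (ward_field_force theta z pc It)).
  apply: (etrans (near_mom (t, z) mE It)).
  have /(ward_expression_eq0 oI rq uw (w := (t, z)) It) -> := W t It z.
  by rewrite /force (mE (t, z) It).
Qed.

End WardEquation.

Theorem proposition6p1 (R : realType) (n : nat) (theta : R) :
  symplectic_form (@ward_form R n theta) /\
  (exists X : fields R n -> fields R n,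
     hamiltonian_vector_field (ward_form theta) (@hamiltonian R n) X) /\
  (forall X : fields R n -> fields R n,
     hamiltonian_vector_field (ward_form theta) (@hamiltonian R n) X ->
     forall (I : set R), open I -> is_interval I ->
     forall p q : R -> (R * R)%type -> 'M[R[i]]_n,
       integral_curve I X (fun t => (p t, q t)) <->
       [/\ group_curve I q,
           forall t, I t -> p t = logder_t q t
         & ward_equation theta I q]).
Proof.
split; first exact: ward_symplectic.
split; first by exists (ward_field theta); exact: ward_field_hamiltonian.
by move=> X HX I oI _ p q; exact: integral_curve_ward.
Qed.
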